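(* Let $m$ and $\nu$ be positive integers, $k,l$ real numbers, $\chi$ a multiplier system of weight $k$ and $\chi_1$ a multiplier system of weight $l$ on $\mathrm{SL}_2(\mathbb{Z})$. Let $f\in J_{k,m,\chi}$ and let $g$ be a modular form of weight $l$ and multiplier system $\chi_1$. Writing $f(\tau,z)=\sum_{\mu=1}^{2m}f_\mu(\tau)\theta_{m,\mu}(\tau,z)$ and $\Psi(f)=\sum_{\mu=1}^{2m}f_\mu\mathbf{e}_\mu$, and similarly for $[f,g]^{\mathrm{hol}}_{k,m,l,\nu}$, we have \[\frac{1}{(4m)^\nu}\Psi\!\left([f,g]^{\mathrm{hol}}_{k,m,l,\nu}\right)=\frac{1}{\nu!}[\Psi(f),g]_\nu,\] where $[\Psi(f),g]_\nu:=\sum_{i=0}^{\nu}(-1)^{\nu-i}\binom{\nu}{i}\frac{\Gamma(k-\frac12+\nu)\Gamma(l+\nu)}{\Gamma(k-\frac12+i)\Gamma(l+\nu-i)}\sum_{\mu=1}^{2m}D_\tau^{i}(f_\mu)\,D_\tau^{\nu-i}(g)\,\mathbf{e}_\mu$.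
   Context: $T=\left(\begin{smallmatrix}1&1\\0&1\end{smallmatrix}\right)$, $D_\tau:=\frac{1}{2\pi i}\frac{\partial}{\partial\tau}$. A multiplier system of weight $k\in\mathbb{R}$ is a map $\chi:\mathrm{SL}_2(\mathbb{Z})\to\{|z|=1\}$ such that $\chi(\gamma)(c\tau+d)^k$ (fixed branch) is an automorphy factor. A modular form of weight $l$ and multiplier $\chi_1$ is a holomorphic $g:\mathbb{H}\to\mathbb{C}$ with $g(\gamma\tau)=\chi_1(\gamma)(c\tau+d)^lg(\tau)$ for all $\gamma=\left(\begin{smallmatrix}a&b\\c&d\end{smallmatrix}\right)\in\mathrm{SL}_2(\mathbb{Z})$ and $g(\tau)=\sum_{n+\kappa\ge0}a(n+\kappa)e^{2\pi i(n+\kappa)\tau}$, $\chi_1(T)=e^{2\pi i\kappa}$. Jacobi group $\Gamma^J=\mathrm{SL}_2(\mathbb{Z})\ltimes\mathbb{Z}^2$ acting via $(f|_{k,m,\chi}M)(\tau,z):=\chi^{-1}(\left(\begin{smallmatrix}a&b\\c&d\end{smallmatrix}\right))(c\tau+d)^{-k}f\!\left(\frac{a\tau+b}{c\tau+d},\frac{z+\lambda\tau+\mu}{c\tau+d}\right)\exp\!\left(2\pi im\left(-\frac{c(z+\lambda\tau+\mu)^2}{c\tau+d}+\lambda^2\tau+2\lambda z\right)\right)$ for $M=[\left(\begin{smallmatrix}a&b\\c&d\end{smallmatrix}\right),(\lambda,\mu)]$. $J_{k,m,\chi}$: holomorphic $f$ on $\mathbb{H}\times\mathbb{C}$, invariant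 under $|_{k,m,\chi}M$ for all $M\in\Gamma^J$, with expansion $\sum_{n,r\in\mathbb{Z},\,r^2-4m(n+\kappa)\le0}c(n+\kappa,r)e^{2\pi i(n+\kappa)\tau}e^{2\pi irz}$ for some $\kappa\in[0,1)$. For $\mu\in\{1,\dots,2m\}$, $\theta_{m,\mu}(\tau,z):=\sum_{r\equiv\mu\ (2m)}e^{2\pi i\frac{r^2}{4m}\tau}e^{2\pi irz}$. Every Jacobi form $F$ of index $m$ has a unique theta decomposition $F=\sum_{\mu=1}^{2m}F_\mu(\tau)\theta_{m,\mu}(\tau,z)$ with $F_\mu:\mathbb{H}\to\mathbb{C}$, and $\Psi(F):=\sum_{\mu}F_\mu\mathbf{e}_\mu$ ($\mathbf{e}_\mu$ standard basis of $\mathbb{C}^{2m}$). $L_m:=-\frac{1}{4\pi^2}\left(8\pi im\frac{\partial}{\partial\tau}-\frac{\partial^2}{\partial z^2}\right)$ and $[f,g]^{\mathrm{hol}}_{k,m,l,\nu}:=\sum_{r+s=\nu}\binom{\nu+k-3/2}{s}\binom{\nu+l-1}{r}(-4m)^sL_m^r(f)D_\tau^s(g)$, with $\binom{x}{s}=\frac{x(x-1)\cdots(x-s+1)}{s!}$; this is a Jacobi form of weight $k+l+2\nu$, index $m$, multiplier $\chi\chi_1$. *)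

(* Defs.v *)
From Stdlib Require Import Reals ZArith List ClassicalEpsilon.
From Coquelicot Require Import Coquelicot.

Local Open Scope C_scope.

(** Functions on the upper half-plane H (resp. on H x C) are total functions on
    [C] (resp. on [C] and [C]) whose values are only constrained for
    [upper tau]. *)

Definition upper (tau : C) : Prop := (0 < Im tau)%R.

(** ** Complex exponential and powers *)

Definition Cexp (z : C) : C :=
  ((exp (Re z) * cos (Im z))%R, (exp (Re z) * sin (Im z))%R).

Definition ee (z : C) : C := Cexp (2 * PI * Ci * z).

(** Principal argument, with values in (-PI, PI]. *)
Definition Carg (w : C) : R :=
  if Rle_dec 0 (Im w) then acos (Re w / Cmod w) else (- acos (Re w / Cmod w))%R.

Definition Clog (w : C) : C := (ln (Cmod w), Carg w).

(** The real power [w ^ k], [w <> 0], for the principal branch. *)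
Definition Cpower (w : C) (k : R) : C := Cexp (k * Clog w).

(** ** Unconditional summation over the elements of [D] *)

(** The filter of "sufficiently large" finite subsets of [D]; a finite subset is
    a duplicate-free list. *)
Definition finite_subsets {I : Type} (D : I -> Prop) : (list I -> Prop) -> Prop :=
  fun Q => exists A : list I,
    (forall i, In i A -> D i) /\
    forall B : list I,
      NoDup B -> (forall i, In i B -> D i) -> incl A B -> Q B.

Definition has_sum {I : Type} (D : I -> Prop) (x : I -> C) (s : C) : Prop :=
  filterlim (fun A : list I => fold_right Cplus 0 (map x A))
            (finite_subsets D) (locally s).

Definition Csum {I : Type} (D : I -> Prop) (x : I -> C) : C :=
  iota (T := C_CompleteNormedModule) (has_sum D x).

(** ** SL_2(Z) and the Jacobi group *)

Record SL2Z : Type := mkSL2Z {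
  sl_a : Z; sl_b : Z; sl_c : Z; sl_d : Z;
  sl_det : (sl_a * sl_d - sl_b * sl_c = 1)%Z }.

Lemma SL2Z_mul_det (g h : SL2Z) :
  ((sl_a g * sl_a h + sl_b g * sl_c h) * (sl_c g * sl_b h + sl_d g * sl_d h) -
   (sl_a g * sl_b h + sl_b g * sl_d h) * (sl_c g * sl_a h + sl_d g * sl_c h)
   = 1)%Z.
Proof.
destruct g as [a b c d e], h as [a' b' c' d' e']; simpl.
transitivity ((a * d - b * c) * (a' * d' - b' * c'))%Z; [ring|].
now rewrite e, e'.
Qed.

Definition SL2Z_mul (g h : SL2Z) : SL2Z := mkSL2Z _ _ _ _ (SL2Z_mul_det g h).

Definition SL2Z_T : SL2Z := mkSL2Z 1 1 0 1 eq_refl.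

Definition autj (g : SL2Z) (tau : C) : C := IZR (sl_c g) * tau + IZR (sl_d g).

Definition moebius (g : SL2Z) (tau : C) : C :=
  (IZR (sl_a g) * tau + IZR (sl_b g)) / autj g tau.

(** The underlying set of SL_2(Z) |x Z^2. *)
Definition JacobiGroup : Type := (SL2Z * (Z * Z))%type.

(** ** Multiplier systems, modular forms, Jacobi forms *)

Definition automorphy_factor (J : SL2Z -> C -> C) : Prop :=
  forall (g h : SL2Z) (tau : C), upper tau ->
    J (SL2Z_mul g h) tau = J g (moebius h tau) * J h tau.

Definition multiplier_system (k : R) (chi : SL2Z -> C) : Prop :=
  (forall g, Cmod (chi g) = 1%R) /\
  automorphy_factor (fun g tau => chi g * Cpower (autj g tau) k).

Definition modular_form (l : R) (chi1 : SL2Z -> C) (g : C -> C) : Prop :=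
  (forall tau, upper tau -> ex_derive (K := C_AbsRing) (V := C_NormedModule) g tau) /\
  (forall gam tau, upper tau ->
     g (moebius gam tau) = chi1 gam * Cpower (autj gam tau) l * g tau) /\
  (exists (kappa : R) (a : Z -> C),
     chi1 SL2Z_T = ee kappa /\
     forall tau, upper tau ->
       has_sum (fun n : Z => (0 <= IZR n + kappa)%R)
               (fun n : Z => a n * ee ((IZR n + kappa)%R * tau)) (g tau)).

Definition jacobi_slash (k : R) (m : nat) (chi : SL2Z -> C) (f : C -> C -> C)
    (M : JacobiGroup) (tau z : C) : C :=
  let gam := fst M in
  let lam : C := IZR (fst (snd M)) in
  let mu : C := IZR (snd (snd M)) in
  let c : C := IZR (sl_c gam) in
  / chi gam * Cpower (autj gam tau) (- k) *
  f (moebius gam tau) ((z + lam * tau + mu) / autj gam tau) *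
  ee (INR m * (- (c * (z + lam * tau + mu) ^ 2 / autj gam tau)
               + lam ^ 2 * tau + 2 * lam * z)).

Definition jacobi_form (k : R) (m : nat) (chi : SL2Z -> C) (f : C -> C -> C) : Prop :=
  (forall tau z, upper tau ->
     ex_filterdiff (K := C_AbsRing)
       (U := prod_NormedModule C_AbsRing C_NormedModule C_NormedModule)
       (V := C_NormedModule)
       (fun p : C * C => f (fst p) (snd p)) (locally (tau, z))) /\
  (forall (M : JacobiGroup) tau z, upper tau ->
     jacobi_slash k m chi f M tau z = f tau z) /\
  (exists (kappa : R) (c : Z -> Z -> C),
     (0 <= kappa < 1)%R /\
     forall tau z, upper tau ->
       has_sum (fun nr : Z * Z =>
                  (IZR (snd nr) ^ 2 - 4 * INR m * (IZR (fst nr) + kappa) <= 0)%R)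
               (fun nr : Z * Z =>
                  c (fst nr) (snd nr) * ee ((IZR (fst nr) + kappa)%R * tau) *
                  ee (IZR (snd nr) * z))
               (f tau z)).

(** ** Theta decomposition *)

Definition theta (m mu : nat) (tau z : C) : C :=
  Csum (fun r : Z => Z.divide (2 * Z.of_nat m) (r - Z.of_nat mu))
       (fun r : Z => ee ((IZR r ^ 2 / (4 * INR m))%R * tau) * ee (IZR r * z)).

(** A C^(2m)-valued function is given by its components [h mu], where
    [1 <= mu <= 2 * m]. *)
Definition theta_decomposition (m : nat) (F : C -> C -> C) (h : nat -> C -> C) : Prop :=
  forall tau z, upper tau ->
    F tau z = sum_n_m (G := C_AbelianGroup)
                (fun mu => h mu tau * theta m mu tau z) 1 (2 * m).

(** [Psi m F mu] is the [mu]-th component of the theta decomposition of [F],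
    which is unique on H for [1 <= mu <= 2 * m]. *)
Definition Psi (m : nat) (F : C -> C -> C) : nat -> C -> C :=
  epsilon (inhabits (fun _ _ => RtoC 0)) (theta_decomposition m F).

(** ** Differential operators and brackets *)

Definition Dtau (g : C -> C) (tau : C) : C := / (2 * PI * Ci) * C_derive g tau.

Definition heat (m : nat) (F : C -> C -> C) (tau z : C) : C :=
  - / (4 * PI ^ 2) *
  (8 * PI * Ci * INR m * C_derive (fun t => F t z) tau
   - C_derive (fun w => C_derive (fun w' => F tau w') w) z).

Fixpoint falling (x : R) (s : nat) : R :=
  match s with
  | O => 1%R
  | S s' => (falling x s' * (x - INR s'))%R
  end.

Definition gbinom (x : R) (s : nat) : R := (falling x s / INR (fact s))%R.

Definition hol_bracket (k : R) (m : nat) (l : R) (nu : nat)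
    (f : C -> C -> C) (g : C -> C) (tau z : C) : C :=
  sum_n (G := C_AbelianGroup)
    (fun r => let s := (nu - r)%nat in
       gbinom (INR nu + k - 3 / 2) s * gbinom (INR nu + l - 1) r *
       (- (4 * INR m)) ^ s *
       Nat.iter r (heat m) f tau z * Nat.iter s Dtau g tau) nu.

(** ** Gamma function *)

Definition Euler_integral (x : R) : R :=
  RInt_gen (V := R_CompleteNormedModule)
    (fun t => (Rpower t (x - 1) * exp (- t))%R) (at_right 0) (Rbar_locally p_infty).

Fixpoint rising (x : R) (n : nat) : R :=
  match n with
  | O => 1%R
  | S n' => (rising x n' * (x + INR n'))%R
  end.

(** Euler's integral for [0 < x] (then [N = 0]), extended to the negative
    non-integers by Gamma (x + 1) = x Gamma x. The value at a pole is
    meaningless. *)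
Definition Gamma (x : R) : R :=
  let N := Z.to_nat (up (- x)) in
  (Euler_integral (x + INR N) / rising x N)%R.

(** Gamma a / Gamma b as the value at [s = 0] of the meromorphic function
    Gamma (a + s) / Gamma (b + s): this gives 0 when only [b] is a pole, and the
    finite limit when both are. *)
Definition Gamma_quotient (a b : R) : R :=
  real (Lim (fun s => (Gamma (a + s) / Gamma (b + s))%R) 0).

Definition RC_bracket (k l : R) (nu : nat) (h : nat -> C -> C) (g : C -> C)
    (mu : nat) (tau : C) : C :=
  sum_n (G := C_AbelianGroup)
    (fun i =>
       (- (1)) ^ (nu - i) * Binomial.C nu i *
       (Gamma_quotient (k - 1 / 2 + INR nu) (k - 1 / 2 + INR i) *
        Gamma_quotient (l + INR nu) (l + INR nu - INR i)) *
       (Nat.iter i Dtau (h mu) tau * Nat.iter (nu - i) Dtau g tau)) nu.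

(* Main.v *)
Require Import Defs.
From Stdlib Require Import Reals ZArith Arith List Permutation ClassicalEpsilon Lra Lia.
From Coquelicot Require Import Coquelicot.

(** The heat operator kills each [theta m mu], so by the product rule it acts on
    [h(tau) * theta m mu] as multiplication by [4 m] composed with [Dtau] on [h].
    Hence the components of the bracket of [f] and [g] are explicit combinations
    of [Dtau^r f_mu * Dtau^s g], and uniqueness of the theta decomposition
    identifies them with [Psi] of the bracket; what remains is
    [Gamma (x + n) / Gamma x = x (x + 1) ... (x + n - 1)].

    The components of [f] come from its Fourier expansion: summing over [n] for
    fixed [r] gives [f = sum_r S_r(tau) e(r^2 tau / 4m) e(rz)], and invariance
    under [z -> z + p tau] makes [S_r] depend only on [r] modulo [2 m]. Each
    [S_r] is an absolutely convergent series in nonnegative powers of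
    [e(tau)], hence can be differentiated termwise arbitrarily often. *)

(** * The Gamma function *)

(** [Psi] is chosen by [epsilon], so nothing is known about it before some decomposition is
    exhibited; the regularity of its components is then transferred by uniqueness. All analysis
    rests on unconditional sums. In C they are the same as absolutely convergent ones, which gives
    slices, reindexing and summation by fibres. Derivatives are handled with real increments only:
    each exponential has a quadratic Taylor error, and these errors can be summed over the series.
    Fourier coefficients in [z] are isolated by averaging over dyadic translates rather than by
    integrating. [Gamma_quotient] is a limit, so its value may be computed on a punctured
    neighbourhood free of poles. There one has to cancel [Gamma], hence to know that it is nonzero;
    this comes from the convergence and positivity of Euler's integral. *)

Lemma at_right_0_lt (d : R) : 0 < d -> at_right 0 (fun a => 0 < a < d).
Proof.
intros hd. exists (mkposreal d hd). intros a ha h. split; [easy|].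
change (Rabs (a - 0) < d) in ha. rewrite Rminus_0_r, Rabs_pos_eq in ha; lra.
Qed.

(** The limit is the supremum of the integrals over compact intervals: as [f] is nonnegative, an
    interval [[a0, b0]] that comes within [eps] of it settles all larger intervals. The upper bound
    by [S] later yields positivity. *)
Lemma is_RInt_gen_nonneg_bounded (f : R -> R) (M : R) :
  (forall a b, 0 < a <= b -> ex_RInt f a b) ->
  (forall t, 0 < t -> 0 <= f t) ->
  (forall a b, 0 < a <= b -> RInt f a b <= M) ->
  exists S, is_RInt_gen f (at_right 0) (Rbar_locally p_infty) S /\
    forall a b, 0 < a <= b -> RInt f a b <= S.
Proof.
intros hex hf hM.
destruct (completeness (fun y => exists a b, 0 < a <= b /\ y = RInt f a b)) as [S [hS1 hS2]].
- exists M. intros y (a & b & h & ->). now apply hM.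
- exists (RInt f 1 1), 1, 1. split; [lra|easy].
- exists S. split.
  2:{ intros a b h. apply hS1. now exists a, b. }
  intros P [eps hP].
  destruct (excluded_middle_informative (exists a b, 0 < a <= b /\ S - eps < RInt f a b))
    as [(a0 & b0 & h0 & hlt)|n].
  + apply Filter_prod with (Q := fun a => 0 < a < a0) (R := fun b => b0 < b).
    * apply at_right_0_lt; lra.
    * now exists b0.
    * intros a b ha hb. exists (RInt f a b). split; [apply (RInt_correct (V := R_CompleteNormedModule)), hex; simpl; lra|].
      apply hP. change (Rabs (RInt f a b - S) < eps).
      assert (h1 : RInt f a b <= S) by (apply hS1; exists a, b; split; [lra|easy]).
      assert (h2 : RInt f a0 b0 <= RInt f a b).
      { rewrite <- (RInt_Chasles f a a0 b), <- (RInt_Chasles f a0 b0 b) by (apply hex; lra).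
        assert (0 <= RInt f a a0) by (apply RInt_ge_0; [lra|apply hex; lra|intros; apply hf; lra]).
        assert (0 <= RInt f b0 b) by (apply RInt_ge_0; [lra|apply hex; lra|intros; apply hf; lra]).
        unfold plus; simpl. lra. }
      apply Rabs_def1; lra.
  + exfalso. assert (S <= S - eps); [|assert (h := cond_pos eps); lra].
    apply hS2. intros y (a & b & h & ->). apply Rnot_lt_le. intros h'. apply n. now exists a, b.
Qed.

(** Disposes of the boundary terms in the integration by parts for Euler's integral. *)
Lemma is_RInt_gen_primitive_vanishing (f Q : R -> R) :
  (forall a b, 0 < a <= b -> is_RInt f a b (Q b - Q a)) ->
  (forall eps, 0 < eps -> exists d, 0 < d /\ forall a, 0 < a < d -> 0 <= Q a < eps) ->
  (forall eps, 0 < eps -> exists B, 0 < B /\ forall b, B < b -> 0 <= Q b < eps) ->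
  is_RInt_gen f (at_right 0) (Rbar_locally p_infty) 0.
Proof.
intros hf h0 h1 P [eps hP].
destruct (h0 eps (cond_pos eps)) as (d & hd & h0'), (h1 eps (cond_pos eps)) as (B & hB & h1').
apply Filter_prod with (Q := fun a => 0 < a < Rmin d B) (R := fun b => B < b).
- apply at_right_0_lt. now apply Rmin_pos.
- now exists B.
- intros a b ha hb. assert (hm := Rmin_l d B). assert (hm' := Rmin_r d B).
  exists (Q b - Q a). split; [apply hf; simpl; lra|].
  apply hP. change (Rabs (Q b - Q a - 0) < eps).
  assert (h2 := h0' a ltac:(lra)). assert (h3 := h1' b hb). apply Rabs_def1; lra.
Qed.

Definition euler_integrand (x t : R) : R := Rpower t (x - 1) * exp (- t).

Lemma euler_integrand_pos x t : 0 < euler_integrand x t.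
Proof. apply Rmult_lt_0_compat; apply exp_pos. Qed.

Lemma euler_integrand_continuous x t : 0 < t -> continuous (euler_integrand x) t.
Proof.
intros ht. apply (ex_derive_continuous (K := R_AbsRing) (V := R_NormedModule)).
unfold euler_integrand, Rpower. auto_derive. lra.
Qed.

Lemma ex_RInt_euler x a b : 0 < a <= b -> ex_RInt (euler_integrand x) a b.
Proof.
intros h. apply (ex_RInt_continuous (V := R_CompleteNormedModule)). intros t ht.
rewrite Rmin_left in ht by lra. apply euler_integrand_continuous; lra.
Qed.

Lemma exp_monotone (x y : R) : x <= y -> exp x <= exp y.
Proof. intros [h| ->]; [now apply Rlt_le, exp_increasing|apply Rle_refl]. Qed.

(** Tangent line of the logarithm at [p], obtained from [1 + u <= exp u] at
    [u = ln ((1 + t) / p)]. *)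
Lemma ln_le_linear (p t : R) : 0 < p -> 0 < t -> p * ln (1 + t) <= t + (1 - p + p * ln p).
Proof.
intros hp ht.
assert (h := exp_ineq1_le (ln ((1 + t) / p))).
rewrite exp_ln, ln_div in h by (try apply Rdiv_lt_0_compat; lra).
apply Rmult_le_compat_l with (r := p) in h; [|lra].
replace (p * ((1 + t) / p)) with (1 + t) in h by (field; lra). lra.
Qed.

(* [G t = (t / (1 + t)) ^ x] is bounded and its derivative dominates the
   integrand at both ends of [(0, oo)]. *)
Lemma Euler_integral_spec (x : R) : 0 < x ->
  is_RInt_gen (euler_integrand x) (at_right 0) (Rbar_locally p_infty) (Euler_integral x) /\
  0 < Euler_integral x.
Proof.
intros hx. set (p := x + 1). set (c := 1 - p + p * ln p).
set (G := fun t => exp (x * (ln t - ln (1 + t)))).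
set (g := fun t => x * exp (x * (ln t - ln (1 + t)) - ln t - ln (1 + t))).
assert (hG : forall t, 0 < t -> 0 < G t < 1).
{ intros t ht. split; [apply exp_pos|]. rewrite <- exp_0. apply exp_increasing.
  assert (ln t < ln (1 + t)) by (apply ln_increasing; lra). nra. }
assert (hg : forall t, 0 < t -> is_derive G t (g t)).
{ intros t ht. unfold G, g. auto_derive; [lra|].
  unfold Rminus at 1 2. rewrite !exp_plus, !exp_Ropp, !exp_ln by lra. 
  unfold Rminus. field. lra. }
(* As [g t = x t^(x-1) (1+t)^(-x-1)], the claim amounts to [(1+t)^p exp(-t) <= exp c] with
   [p = x + 1], which is [ln_le_linear]. *)
assert (hle : forall t, 0 < t -> euler_integrand x t <= exp c / x * g t).
{ intros t ht. unfold euler_integrand, g, Rpower.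
  replace (exp c / x * (x * exp (x * (ln t - ln (1 + t)) - ln t - ln (1 + t))))
    with (exp c * exp (x * (ln t - ln (1 + t)) - ln t - ln (1 + t))) by (field; lra).
  rewrite <- !exp_plus. apply exp_monotone.
  assert (h := ln_le_linear p t ltac:(unfold p; lra) ht). fold c in h. unfold p in h. lra. }
assert (hI : forall a b, 0 < a <= b -> is_RInt (fun t => exp c / x * g t) a b (exp c / x * (G b - G a))).
{ intros a b h. apply (is_RInt_scal (V := R_NormedModule)).
  apply (is_RInt_derive (V := R_CompleteNormedModule)); intros t ht; rewrite Rmin_left in ht by lra.
  - apply hg; lra.
  - apply (ex_derive_continuous (K := R_AbsRing) (V := R_NormedModule)).
    unfold g. auto_derive. lra. }
assert (hc : 0 < exp c / x) by (apply Rdiv_lt_0_compat; [apply exp_pos|easy]).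
destruct (is_RInt_gen_nonneg_bounded (euler_integrand x) (exp c / x)) as (S & hS & hS').
- apply ex_RInt_euler.
- intros; apply Rlt_le, euler_integrand_pos.
- intros a b h.
  apply Rle_trans with (exp c / x * (G b - G a)).
  + rewrite <- (is_RInt_unique _ _ _ _ (hI a b h)).
    apply RInt_le; [lra|now apply ex_RInt_euler|now exists (exp c / x * (G b - G a)); apply hI|].
    intros t ht. apply hle; lra.
  + assert (h1 := hG a ltac:(lra)). assert (h2 := hG b ltac:(lra)).
    rewrite <- (Rmult_1_r (exp c / x)) at 2. apply Rmult_le_compat_l; lra.
- assert (e : Euler_integral x = S) by (apply (is_RInt_gen_unique _ _ hS)).
  rewrite e. split; [easy|].
  apply Rlt_le_trans with (RInt (euler_integrand x) 1 2); [|apply hS'; lra].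
  apply RInt_gt_0; [lra|intros; apply euler_integrand_pos|].
  intros t ht; apply euler_integrand_continuous; lra.
Qed.

(** Integration by parts: [t^x exp(-t)], written [exp (x * ln t - t)], is a primitive of the
    difference of the two integrands and tends to 0 at both ends. *)
Lemma Euler_integral_succ (x : R) : 0 < x -> Euler_integral (x + 1) = x * Euler_integral x.
Proof.
intros hx.
destruct (Euler_integral_spec x hx) as [h1 _].
destruct (Euler_integral_spec (x + 1) ltac:(lra)) as [h2 _].
assert (h3 := is_RInt_gen_minus _ _ _ _ (is_RInt_gen_scal _ x _ h1) h2).
assert (h4 : is_RInt_gen (fun t => minus (scal x (euler_integrand x t)) (euler_integrand (x + 1) t))
   (at_right 0) (Rbar_locally p_infty) 0).
{ apply is_RInt_gen_primitive_vanishing with (Q := fun t => exp (x * ln t - t)).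
  - intros a b h. apply (is_RInt_derive (V := R_CompleteNormedModule) (fun t => exp (x * ln t - t)));
      intros t ht; rewrite Rmin_left in ht by lra.
    + unfold euler_integrand, Rpower. auto_derive; [lra|].
      unfold minus, plus, opp, scal; simpl; unfold mult; simpl.
      rewrite <- !exp_plus.
      replace (x * ln t + - t) with ((x - 1) * ln t + - t + ln t) by ring.
      replace ((x + 1 - 1) * ln t + - t) with ((x - 1) * ln t + - t + ln t) by ring.
      rewrite !(exp_plus _ (ln t)), exp_ln by lra. field. lra.
    + apply (continuous_minus (V := R_NormedModule)).
      * apply (continuous_scal_r (V := R_NormedModule)), euler_integrand_continuous; lra.
      * apply euler_integrand_continuous; lra.
  - intros eps he. exists (exp (ln eps / x)). split; [apply exp_pos|].
    intros a ha. split; [apply Rlt_le, exp_pos|].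
    rewrite <- (exp_ln eps) by easy. apply exp_increasing.
    assert (h : ln a < ln eps / x) by (rewrite <- (ln_exp (ln eps / x)); apply ln_increasing; lra).
    apply Rmult_lt_compat_l with (r := x) in h; auto.
    replace (x * (ln eps / x)) with (ln eps) in h by (field; lra). lra.
  (* By [ln_le_linear] with exponent [x + 1], [x ln b - b < c - ln b]; the right side is below
     [ln eps] once [b > exp (c - ln eps)]. *)
  - intros eps he. set (p := x + 1). set (c := 1 - p + p * ln p).
    assert (hB : 0 < exp (c - ln eps)) by apply exp_pos.
    exists (exp (c - ln eps)). split; [easy|].
    intros b hb. split; [apply Rlt_le, exp_pos|].
    rewrite <- (exp_ln eps) by easy. apply exp_increasing.
    assert (h := ln_le_linear p b ltac:(unfold p; lra) ltac:(lra)). fold c in h. unfold p in h.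
    assert (h5 : c - ln eps < ln b) by (rewrite <- (ln_exp (c - ln eps)); apply ln_increasing; lra).
    assert (h6 : ln b < ln (1 + b)) by (apply ln_increasing; lra). nra. }
assert (e : x * Euler_integral x - Euler_integral (x + 1) = 0).
{ transitivity (RInt_gen (V := R_CompleteNormedModule)
    (fun t => minus (scal x (euler_integrand x t)) (euler_integrand (x + 1) t))
    (at_right 0) (Rbar_locally p_infty)); [symmetry|]; now apply is_RInt_gen_unique. }
lra.
Qed.

(** * Recurrence and nonvanishing of Gamma, and quotients of its values *)

Lemma rising_succ_l (x : R) (n : nat) : rising x (S n) = x * rising (x + 1) n.
Proof.
induction n as [|n IH]; [simpl; ring|].
change (rising x (S (S n))) with (rising x (S n) * (x + INR (S n))).
rewrite IH, S_INR. simpl. ring.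
Qed.

Lemma rising_neq_0 (x : R) (n : nat) : (forall i : nat, x + INR i <> 0) -> rising x n <> 0.
Proof.
intros h; induction n as [|n IH]; simpl; [lra|]. now apply Rmult_integral_contrapositive.
Qed.

Lemma Gamma_index_pos (x : R) : 0 < x + INR (Z.to_nat (up (- x))).
Proof.
destruct (archimed (- x)) as [h _]. rewrite INR_IZR_INZ.
assert (IZR (up (- x)) <= IZR (Z.of_nat (Z.to_nat (up (- x))))) by (apply IZR_le; lia). lra.
Qed.

Lemma Gamma_neq_0 (x : R) : (forall i : nat, x + INR i <> 0) -> Gamma x <> 0.
Proof.
intros h. unfold Gamma. apply Rmult_integral_contrapositive_currified.
- apply Rgt_not_eq, Euler_integral_spec, Gamma_index_pos.
- apply Rinv_neq_0_compat. now apply rising_neq_0.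
Qed.

Lemma Gamma_succ (x : R) : (forall i : nat, x + INR i <> 0) -> Gamma (x + 1) = x * Gamma x.
Proof.
intros h. unfold Gamma.
assert (e : up (- (x + 1)) = (up (- x) - 1)%Z).
{ destruct (archimed (- x)) as [h1 h2].
  symmetry; apply tech_up; rewrite minus_IZR; lra. }
(* If [up (- x) <= 0] then [x > 0] and both sides are plain Euler integrals. Otherwise both shifts
   reach the same argument, and only the factors [rising] differ. *)
rewrite e. destruct (Z_le_dec (up (- x)) 0) as [hu|hu].
- replace (Z.to_nat (up (- x) - 1)) with 0%nat by lia.
  replace (Z.to_nat (up (- x))) with 0%nat by lia.
  destruct (archimed (- x)) as [h1 _]. apply IZR_le in hu. simpl.
  rewrite !Rplus_0_r, Euler_integral_succ by lra. field.
- assert (hp := Gamma_index_pos x).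
  replace (Z.to_nat (up (- x))) with (S (Z.to_nat (up (- x) - 1))) by lia.
  rewrite rising_succ_l, S_INR.
  replace (x + (INR (Z.to_nat (up (- x) - 1)) + 1)) with (x + 1 + INR (Z.to_nat (up (- x) - 1))) by ring.
  field. split.
  + apply rising_neq_0. intros i. rewrite Rplus_assoc, (Rplus_comm 1), <- S_INR. apply h.
  + specialize (h 0%nat). simpl in h. lra.
Qed.

Lemma Gamma_add (x : R) (n : nat) : (forall i : nat, x + INR i <> 0) ->
  Gamma (x + INR n) = rising x n * Gamma x.
Proof.
intros h; induction n as [|n IH].
- simpl. rewrite Rplus_0_r. ring.
- rewrite S_INR, <- Rplus_assoc, Gamma_succ, IH; [simpl; ring|].
  intros i. rewrite Rplus_assoc, <- plus_INR. apply h.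
Qed.

Lemma continuity_pt_rising (b : R) (n : nat) (s : R) : continuity_pt (fun s => rising (b + s) n) s.
Proof.
induction n as [|n IH]; simpl.
- apply continuity_pt_const. now intros ? ?.
- apply continuity_pt_mult; [easy|].
  apply continuity_pt_plus; [|apply continuity_pt_const; now intros ? ?].
  apply continuity_pt_plus; [apply continuity_pt_const; now intros ? ?|].
  apply derivable_continuous_pt, derivable_pt_id.
Qed.

(** For small [s <> 0] the point [b + s] lies strictly between two consecutive integers. The case
    [up b - b = 1] is that of an integer [b], where the interval depends on the sign of [s]. *)
Lemma poles_discrete (b : R) : exists d : posreal,
  forall s, Rabs s < d -> s <> 0 -> forall i : nat, b + s + INR i <> 0.
Proof.
destruct (archimed b) as [h1 h2]. set (q := up b) in *.
assert (hz : forall (y : R) (z : Z) (i : nat), IZR z < y < IZR z + 1 -> y + INR i <> 0).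
{ intros y z i hy e. rewrite INR_IZR_INZ in e.
  assert (hlo : (z < - Z.of_nat i)%Z) by (apply lt_IZR; rewrite opp_IZR; lra).
  assert (hhi : (- Z.of_nat i < z + 1)%Z) by (apply lt_IZR; rewrite opp_IZR, plus_IZR; lra). lia. }
destruct (Req_dec (IZR q - b) 1) as [e|n].
- exists (mkposreal 1 Rlt_0_1). simpl. intros s hs hn i. apply Rabs_def2 in hs.
  destruct (Rlt_le_dec s 0) as [hlt|hle].
  + apply (hz _ (q - 2)%Z). rewrite minus_IZR. lra.
  + apply (hz _ (q - 1)%Z). rewrite minus_IZR. lra.
- assert (hd : 0 < Rmin (IZR q - b) (1 - (IZR q - b))) by (apply Rmin_pos; lra).
  exists (mkposreal _ hd). simpl. intros s hs _ i. apply Rabs_def2 in hs.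
  assert (hm := Rmin_l (IZR q - b) (1 - (IZR q - b))).
  assert (hm' := Rmin_r (IZR q - b) (1 - (IZR q - b))).
  apply (hz _ (q - 1)%Z). rewrite minus_IZR. lra.
Qed.

(** True also when [b] is a pole: on a punctured neighbourhood the quotient is the polynomial
    [rising (b + s) n], which is continuous at [s = 0]. *)
Lemma Gamma_quotient_add (b : R) (n : nat) : Gamma_quotient (b + INR n) b = rising b n.
Proof.
unfold Gamma_quotient.
rewrite (is_lim_unique _ 0 (Finite (rising b n))); [easy|].
destruct (poles_discrete b) as [d hd].
apply is_lim_ext_loc with (fun s => rising (b + s) n).
- exists d. intros s hs hn. change (Rabs (s - 0) < d) in hs. rewrite Rminus_0_r in hs.
  specialize (hd s hs hn).
  replace (b + INR n + s) with (b + s + INR n) by ring.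
  rewrite Gamma_add by easy. field. now apply Gamma_neq_0.
- replace (rising b n) with (rising (b + 0) n) by (now rewrite Rplus_0_r).
  apply (is_lim_continuity (fun s => rising (b + s) n)), continuity_pt_rising.
Qed.

Lemma falling_rising (x : R) (n : nat) : falling (x + INR n - 1) n = rising x n.
Proof.
revert x; induction n as [|n IH]; intros x; [easy|].
rewrite rising_succ_l, <- IH, S_INR. simpl.
replace (x + 1 + INR n - 1) with (x + (INR n + 1) - 1) by ring. ring.
Qed.

Local Open Scope C_scope.

(** * Unconditional sums *)

Lemma choice_function {A B : Type} (P : A -> B -> Prop) :
  (forall x, exists y, P x y) -> exists f, forall x, P x (f x).
Proof.
intros h. exists (fun x => proj1_sig (constructive_indefinite_description _ (h x))).
intros x. exact (proj2_sig (constructive_indefinite_description _ (h x))).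
Qed.

(** * Finite sums over lists *)

Definition decb (P : Prop) : bool :=
  if excluded_middle_informative P then true else false.

Lemma decb_true (P : Prop) : decb P = true <-> P.
Proof. unfold decb; destruct (excluded_middle_informative P); split; auto; discriminate. Qed.

Lemma decb_false (P : Prop) : decb P = false <-> ~ P.
Proof. unfold decb; destruct (excluded_middle_informative P); split; tauto || discriminate. Qed.

Definition csum {I : Type} (x : I -> C) (A : list I) : C :=
  fold_right Cplus 0 (map x A).

Definition rsum {I : Type} (x : I -> R) (A : list I) : R :=
  fold_right Rplus 0%R (map x A).

Definition outside {I : Type} (A B : list I) : list I :=
  filter (fun i => negb (decb (In i A))) B.

Definition inside {I : Type} (A B : list I) : list I :=
  filter (fun i => decb (In i A)) B.

Lemma in_outside {I : Type} (A B : list I) i : In i (outside A B) <-> In i B /\ ~ In i A.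
Proof.
unfold outside; rewrite filter_In, Bool.negb_true_iff, decb_false; tauto.
Qed.

Lemma in_inside {I : Type} (A B : list I) i : In i (inside A B) <-> In i B /\ In i A.
Proof. unfold inside; rewrite filter_In, decb_true; tauto. Qed.

Lemma filter_permutation {I : Type} (p : I -> bool) (B : list I) :
  Permutation B (filter p B ++ filter (fun i => negb (p i)) B).
Proof.
induction B as [|b B IH]; simpl; [constructor|].
destruct (p b); simpl; [now constructor|].
now apply Permutation_cons_app.
Qed.

Lemma incl_permutation {I : Type} (A B : list I) :
  NoDup A -> incl A B -> exists A', Permutation B (A ++ A').
Proof.
intros HA; revert B; induction HA as [|a A ha HA IH]; intros B hB.
- now exists B.
- destruct (in_split a B) as (B1 & B2 & ->); [apply hB; now left|].
  destruct (IH (B1 ++ B2)) as [A' h].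
  + intros i hi. specialize (hB i (or_intror hi)).
    apply in_app_iff in hB; apply in_app_iff.
    destruct hB as [h|[h|h]]; subst; tauto.
  + exists A'; simpl.
    now rewrite <- h, <- Permutation_middle.
Qed.

Lemma outside_permutation {I : Type} (A B : list I) :
  NoDup A -> NoDup B -> incl A B -> Permutation B (A ++ outside A B).
Proof.
intros hA hB hAB. rewrite (filter_permutation (fun i => decb (In i A)) B) at 1.
apply Permutation_app_tail, NoDup_Permutation; [now apply NoDup_filter|easy|].
intros i; fold (inside A B); rewrite in_inside. split; [tauto|]. intros h; auto.
Qed.

Lemma csum_cons {I : Type} (x : I -> C) a A : csum x (a :: A) = x a + csum x A.
Proof. easy. Qed.

Lemma csum_app {I : Type} (x : I -> C) A B : csum x (A ++ B) = csum x A + csum x B.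
Proof.
induction A as [|a A IH]; simpl; [unfold csum at 2; simpl; ring|].
unfold csum in *; simpl; rewrite IH; ring.
Qed.

Lemma rsum_app {I : Type} (x : I -> R) A B : rsum x (A ++ B) = (rsum x A + rsum x B)%R.
Proof.
induction A as [|a A IH]; simpl; [unfold rsum at 2; simpl; ring|].
unfold rsum in *; simpl; rewrite IH; ring.
Qed.

Lemma csum_perm {I : Type} (x : I -> C) A B : Permutation A B -> csum x A = csum x B.
Proof.
induction 1; unfold csum in *; simpl; try congruence. ring.
Qed.

Lemma rsum_perm {I : Type} (x : I -> R) A B : Permutation A B -> rsum x A = rsum x B.
Proof.
induction 1; unfold rsum in *; simpl; try congruence. ring.
Qed.

Lemma csum_ext_in {I : Type} (x y : I -> C) A :
  (forall i, In i A -> x i = y i) -> csum x A = csum y A.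
Proof.
intros h; unfold csum; f_equal. now apply map_ext_in.
Qed.

Lemma csum_zero {I : Type} (x : I -> C) A : (forall i, In i A -> x i = 0) -> csum x A = 0.
Proof.
induction A as [|a A IH]; intros h; [easy|].
change (x a + csum x A = 0). rewrite (h a), IH; [ring| |now left].
intros i hi; apply h; now right.
Qed.

Lemma csum_plus {I : Type} (x y : I -> C) A :
  csum (fun i => x i + y i) A = csum x A + csum y A.
Proof.
induction A as [|a A IH]; unfold csum in *; simpl; [ring|rewrite IH; ring].
Qed.

Lemma csum_scal {I : Type} (c : C) (x : I -> C) A :
  csum (fun i => c * x i) A = c * csum x A.
Proof.
induction A as [|a A IH]; unfold csum in *; simpl; [ring|rewrite IH; ring].
Qed.

Lemma rsum_map {I J : Type} (u : I -> J) (x : J -> R) A :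
  rsum x (map u A) = rsum (fun i => x (u i)) A.
Proof. unfold rsum; now rewrite map_map. Qed.

Lemma rsum_scal {I : Type} (c : R) (x : I -> R) A :
  rsum (fun i => c * x i)%R A = (c * rsum x A)%R.
Proof.
induction A as [|a A IH]; unfold rsum in *; simpl; [ring|rewrite IH; ring].
Qed.

Lemma rsum_plus {I : Type} (x y : I -> R) A :
  rsum (fun i => x i + y i)%R A = (rsum x A + rsum y A)%R.
Proof.
induction A as [|a A IH]; unfold rsum in *; simpl; [ring|rewrite IH; ring].
Qed.

Lemma rsum_le {I : Type} (x y : I -> R) A :
  (forall i, In i A -> x i <= y i)%R -> (rsum x A <= rsum y A)%R.
Proof.
induction A as [|a A IH]; intros h; [apply Rle_refl|].
apply Rplus_le_compat; [apply h; now left|apply IH; intros; apply h; now right].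
Qed.

Lemma rsum_nonneg {I : Type} (x : I -> R) A :
  (forall i, In i A -> 0 <= x i)%R -> (0 <= rsum x A)%R.
Proof.
intros h. induction A as [|a A IH]; [apply Rle_refl|].
apply Rplus_le_le_0_compat; [apply h; now left|apply IH; intros; apply h; now right].
Qed.

Lemma rsum_incl {I : Type} (x : I -> R) A B :
  (forall i, 0 <= x i)%R -> NoDup A -> incl A B -> (rsum x A <= rsum x B)%R.
Proof.
intros hx hA hAB. destruct (incl_permutation A B hA hAB) as [A' h].
rewrite (rsum_perm x _ _ h), rsum_app.
assert (0 <= rsum x A')%R by now apply rsum_nonneg. lra.
Qed.

Lemma Cmod_csum {I : Type} (x : I -> C) A :
  (Cmod (csum x A) <= rsum (fun i => Cmod (x i)) A)%R.
Proof.
induction A as [|a A IH]; [unfold csum, rsum; simpl; rewrite Cmod_0; lra|].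
eapply Rle_trans; [apply Cmod_triangle|].
now apply Rplus_le_compat_l.
Qed.

Lemma fst_csum {I : Type} (x : I -> C) A : fst (csum x A) = rsum (fun i => fst (x i)) A.
Proof. induction A as [|a A IH]; [easy|]. unfold csum, rsum in *; simpl; now rewrite IH. Qed.

Lemma snd_csum {I : Type} (x : I -> C) A : snd (csum x A) = rsum (fun i => snd (x i)) A.
Proof. induction A as [|a A IH]; [easy|]. unfold csum, rsum in *; simpl; now rewrite IH. Qed.

(** [has_sum] over the whole index type, with the filter unfolded. A domain [D] is treated by
    extending the terms by zero ([restrict]), so that sums over different domains can be
    combined. *)
Definition hsum {I : Type} (x : I -> C) (s : C) : Prop :=
  forall eps : R, (0 < eps)%R -> exists A : list I,
    forall B, NoDup B -> incl A B -> (Cmod (csum x B - s) < eps)%R.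

Definition summable {I : Type} (x : I -> C) : Prop :=
  exists M : R, forall A, NoDup A -> (rsum (fun i => Cmod (x i)) A <= M)%R.

Definition restrict {I : Type} (D : I -> Prop) (x : I -> C) (i : I) : C :=
  if excluded_middle_informative (D i) then x i else 0.

Lemma restrict_in {I : Type} (D : I -> Prop) x i : D i -> restrict D x i = x i.
Proof. unfold restrict; destruct excluded_middle_informative; tauto. Qed.

Lemma restrict_out {I : Type} (D : I -> Prop) x i : ~ D i -> restrict D x i = 0.
Proof. unfold restrict; destruct excluded_middle_informative; tauto. Qed.

Definition ceq_dec {I : Type} (i j : I) : {i = j} + {i <> j} :=
  excluded_middle_informative (i = j).

Lemma hsum_ext {I : Type} (x y : I -> C) s : (forall i, x i = y i) -> hsum x s -> hsum y s.
Proof.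
intros e h eps he. destruct (h eps he) as [A hA]. exists A; intros B h1 h2.
rewrite (csum_ext_in y x); auto.
Qed.

Lemma hsum_unique {I : Type} (x : I -> C) s t : hsum x s -> hsum x t -> s = t.
Proof.
intros hs ht. destruct (Req_dec (Cmod (t - s)) 0) as [e|e].
{ apply Cmod_eq_0 in e. replace t with (s + (t - s)) by ring. rewrite e; ring. }
assert (0 < Cmod (t - s))%R by (assert (h := Cmod_ge_0 (t - s)); lra).
destruct (hs (Cmod (t - s) / 2)%R) as [A hA]; [lra|].
destruct (ht (Cmod (t - s) / 2)%R) as [B hB]; [lra|].
set (L := nodup ceq_dec (A ++ B)).
assert (hL : NoDup L) by apply NoDup_nodup.
specialize (hA L hL). specialize (hB L hL).
assert (Cmod (csum x L - s) < Cmod (t - s) / 2)%R.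
{ apply hA. intros i hi. apply nodup_In, in_or_app; now left. }
assert (Cmod (csum x L - t) < Cmod (t - s) / 2)%R.
{ apply hB. intros i hi. apply nodup_In, in_or_app; now right. }
assert (h := Cmod_triangle (csum x L - s) (- (csum x L - t))).
rewrite Cmod_opp in h.
replace (csum x L - s + - (csum x L - t)) with (t - s) in h by ring. lra.
Qed.

Lemma hsum_plus {I : Type} (x y : I -> C) s t :
  hsum x s -> hsum y t -> hsum (fun i => x i + y i) (s + t).
Proof.
intros hs ht eps he.
destruct (hs (eps / 2)%R) as [A hA]; [lra|].
destruct (ht (eps / 2)%R) as [B hB]; [lra|].
exists (A ++ B). intros L hL hi. rewrite csum_plus.
replace (csum x L + csum y L - (s + t)) with ((csum x L - s) + (csum y L - t)) by ring.
eapply Rle_lt_trans; [apply Cmod_triangle|].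
assert (Cmod (csum x L - s) < eps / 2)%R by (apply hA; auto; intros i h; apply hi, in_or_app; auto).
assert (Cmod (csum y L - t) < eps / 2)%R by (apply hB; auto; intros i h; apply hi, in_or_app; auto).
lra.
Qed.

Lemma hsum_zero {I : Type} : hsum (fun _ : I => 0) 0.
Proof.
intros eps he; exists nil; intros B _ _. rewrite csum_zero by easy.
replace (0 - 0) with (RtoC 0) by ring. now rewrite Cmod_0.
Qed.

Lemma hsum_scal {I : Type} (c : C) (x : I -> C) s : hsum x s -> hsum (fun i => c * x i) (c * s).
Proof.
intros hs eps he.
assert (0 < Cmod c + 1)%R by (assert (h := Cmod_ge_0 c); lra).
destruct (hs (eps / (Cmod c + 1))%R) as [A hA]; [now apply Rdiv_lt_0_compat|].
exists A; intros B h1 h2. rewrite csum_scal.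
replace (c * csum x B - c * s) with (c * (csum x B - s)) by ring. rewrite Cmod_mult.
specialize (hA B h1 h2).
apply Rle_lt_trans with ((Cmod c + 1) * Cmod (csum x B - s))%R.
{ apply Rmult_le_compat_r; [apply Cmod_ge_0|lra]. }
apply Rmult_lt_compat_l with (r := (Cmod c + 1)%R) in hA; auto.
replace ((Cmod c + 1) * (eps / (Cmod c + 1)))%R with eps in hA by (field; lra). easy.
Qed.

Lemma hsum_minus {I : Type} (x y : I -> C) s t :
  hsum x s -> hsum y t -> hsum (fun i => x i - y i) (s - t).
Proof.
intros hx hy. replace (s - t) with (s + (- (1)) * t) by ring.
eapply hsum_ext; [|apply hsum_plus; [exact hx|apply hsum_scal, hy]].
intros i; simpl; ring.
Qed.

Lemma hsum_bound {I : Type} (x : I -> C) s (M : R) :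
  (forall A, NoDup A -> (rsum (fun i => Cmod (x i)) A <= M)%R) ->
  hsum x s -> (Cmod s <= M)%R.
Proof.
intros hM hs. apply le_epsilon; intros eps he.
destruct (hs eps he) as [A hA].
set (L := nodup ceq_dec A).
assert (hL : NoDup L) by apply NoDup_nodup.
specialize (hA L hL). specialize (hM L hL).
assert (Cmod (csum x L - s) < eps)%R by (apply hA; intros i; apply nodup_In).
assert (h := Cmod_triangle (csum x L) (- (csum x L - s))).
rewrite Cmod_opp in h.
replace (csum x L + - (csum x L - s)) with s in h by ring.
assert (h' := Cmod_csum x L). lra.
Qed.

(** Terms off the image of [u] vanish, so a finite sum over [B] equals the sum over the preimage of
    [B]. Used both to embed a slice of a double series and to shift an index. *)
Lemma hsum_inj {I J : Type} (u : I -> J) (y : J -> C) s :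
  (forall i i', u i = u i' -> i = i') ->
  (forall j, (exists i, j = u i) \/ y j = 0) ->
  hsum (fun i => y (u i)) s -> hsum y s.
Proof.
intros hu hy hs eps he. destruct (hs eps he) as [A hA].
exists (map u A). intros B hB hAB.
assert (key : exists B0, NoDup B0 /\ (forall i, In i B0 <-> In (u i) B) /\
          csum (fun i => y (u i)) B0 = csum y B).
{ clear hA hAB. induction hB as [|b B hb hB IH].
  - exists nil; repeat split; try easy; constructor.
  - destruct IH as (B0 & h1 & h2 & h3).
    destruct (excluded_middle_informative (exists i, b = u i)) as [[i ->]|n].
    + exists (i :: B0). split; [constructor; auto; now rewrite h2|]. split.
      * intros i'; simpl; rewrite h2. split; intros [e|e]; subst; auto.
      * unfold csum in *; simpl; now rewrite h3.
    + exists B0; split; auto; split.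
      * intros i; rewrite h2; simpl. split; auto. intros [e|e]; auto.
        exfalso; apply n; now exists i.
      * destruct (hy b) as [e|e]; [tauto|].
        unfold csum in *; simpl; rewrite h3, e; ring. }
destruct key as (B0 & h1 & h2 & h3). rewrite <- h3. apply hA; auto.
intros i hi. apply h2, hAB, in_map, hi.
Qed.

(** Take [A] whose sum of moduli is within [eps] of the supremum: a disjoint [B] of larger weight
    would make [A ++ B] exceed it. *)
Lemma summable_tail {I : Type} (x : I -> C) : summable x ->
  forall eps : R, (0 < eps)%R -> exists A, NoDup A /\
    forall B, NoDup B -> (forall i, In i B -> ~ In i A) ->
      (rsum (fun i => Cmod (x i)) B <= eps)%R.
Proof.
intros [M hM] eps he.
set (E := fun t => exists A, NoDup A /\ t = rsum (fun i => Cmod (x i)) A).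
destruct (completeness E) as [S [hS1 hS2]].
- exists M. intros t (A & hA & ->). now apply hM.
- exists 0%R, nil. split; [constructor|reflexivity].
- destruct (excluded_middle_informative (exists A, NoDup A /\ (S - eps < rsum (fun i => Cmod (x i)) A)%R))
    as [(A & h1 & h2)|n].
  + exists A; split; auto. intros B hB hd.
    assert (rsum (fun i => Cmod (x i)) (A ++ B) <= S)%R.
    { apply hS1. exists (A ++ B); split; auto.
      apply NoDup_app; auto. intros i hi hi'; exact (hd i hi' hi). }
    rewrite rsum_app in H. lra.
  + exfalso. assert (S <= S - eps)%R; [|lra].
    apply hS2. intros t (A & hA & ->). apply Rnot_lt_le. intros h; apply n; now exists A.
Qed.

Lemma summable_le {I : Type} (x y : I -> C) (K : R) :
  (forall i, Cmod (x i) <= K * Cmod (y i))%R -> (0 <= K)%R -> summable y -> summable x.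
Proof.
intros h hK [M hM]; exists (K * M)%R. intros A hA.
eapply Rle_trans; [apply rsum_le; intros i _; apply h|].
rewrite rsum_scal. now apply Rmult_le_compat_l, hM.
Qed.

Lemma summable_ext {I : Type} (x y : I -> C) :
  (forall i, x i = y i) -> summable x -> summable y.
Proof.
intros h hx. apply summable_le with x 1%R; auto; [|lra].
intros i; rewrite h; lra.
Qed.

Lemma summable_scal {I : Type} (c : C) (x : I -> C) :
  summable x -> summable (fun i => c * x i).
Proof.
apply summable_le with (Cmod c); [|apply Cmod_ge_0].
intros i; rewrite Cmod_mult; lra.
Qed.

Lemma summable_inj {I J : Type} (u : I -> J) (y : J -> C) :
  (forall i i', u i = u i' -> i = i') -> summable y -> summable (fun i => y (u i)).
Proof.
intros hu [M hM]; exists M. intros A hA.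
rewrite <- (rsum_map u (fun j => Cmod (y j))). apply hM.
now apply FinFun.Injective_map_NoDup.
Qed.

#[local] Instance finite_subsets_filter {I : Type} (D : I -> Prop) : ProperFilter (finite_subsets D).
Proof.
constructor.
- intros P (A & hA & h). exists (nodup ceq_dec A). apply h.
  + apply NoDup_nodup.
  + intros i hi. now apply hA, (nodup_In ceq_dec).
  + intros i. apply nodup_In.
- constructor.
  + exists nil; easy.
  + intros P Q (A & hA & h) (B & hB & h'). exists (A ++ B). split.
    * intros i hi. apply in_app_or in hi. destruct hi; auto.
    * intros L h1 h2 h3. split; [apply h|apply h']; auto; intros i hi; apply h3, in_or_app; auto.
  + intros P Q hPQ (A & hA & h). exists A; auto.
Qed.

Lemma has_sum_unique {I : Type} (D : I -> Prop) (x : I -> C) s :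
  has_sum D x s -> Csum D x = s.
Proof.
intros h. unfold Csum, has_sum.
apply (iota_filterlim_locally (V := C_CompleteNormedModule) (F := finite_subsets D)
   (fun A : list I => fold_right Cplus 0 (map x A)) s h).
Qed.

Lemma csum_restrict {I : Type} (D : I -> Prop) (x : I -> C) B :
  csum (restrict D x) B = csum x (filter (fun i => decb (D i)) B).
Proof.
induction B as [|b B IH]; [easy|]. unfold csum in *; simpl; rewrite IH.
unfold restrict, decb. destruct excluded_middle_informative; simpl; ring.
Qed.

Lemma has_sum_spec {I : Type} (D : I -> Prop) (x : I -> C) s :
  has_sum D x s <-> forall eps : R, (0 < eps)%R -> finite_subsets D (fun A => (Cmod (csum x A - s) < eps)%R).
Proof.
unfold has_sum. rewrite (filterlim_locally (U := C_UniformSpace)). split.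
- intros h eps he.
  (* Balls of the uniform structure on C are squares; the one of half-side [eps / sqrt 2] lies in
     the disc of radius [eps]. *)
  assert (hs : (0 < sqrt 2)%R) by (apply sqrt_lt_R0; lra).
  assert (he' : (0 < eps / sqrt 2)%R) by now apply Rdiv_lt_0_compat.
  generalize (h (mkposreal _ he')). apply filter_imp. intros A hA.
  apply C_NormedModule_mixin_compat2 in hA. simpl in hA.
  replace (sqrt 2 * (eps / sqrt 2))%R with eps in hA by (field; lra). exact hA.
- intros h eps. generalize (h eps (cond_pos eps)). apply filter_imp. intros A hA.
  now apply C_NormedModule_mixin_compat1.
Qed.

Lemma has_sum_restrict {I : Type} (D : I -> Prop) (x : I -> C) s :
  has_sum D x s <-> hsum (restrict D x) s.
Proof.
rewrite has_sum_spec. split; intros h eps he.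
- destruct (h eps he) as (A & hA & h'). exists A. intros B h1 h2.
  rewrite csum_restrict. apply h'.
  + now apply NoDup_filter.
  + intros i; rewrite filter_In, decb_true; tauto.
  + intros i hi; rewrite filter_In, decb_true; auto.
- destruct (h eps he) as (A & hA).
  exists (filter (fun i => decb (D i)) A). split.
  { intros i; rewrite filter_In, decb_true; tauto. }
  intros B h1 h2 h3.
  (* [hA] only speaks of lists containing all of [A]; the indices of [A] outside [D] are therefore
     appended to [B], where they contribute 0. *)
  set (A' := filter (fun i => negb (decb (D i))) (nodup ceq_dec A)).
  assert (hA' : forall i, In i A' <-> In i A /\ ~ D i).
  { intros i; unfold A'. rewrite filter_In, nodup_In, Bool.negb_true_iff, decb_false; tauto. }
  assert (e : csum x B = csum (restrict D x) (B ++ A')).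
  { rewrite csum_app, (csum_zero _ A'), Cplus_0_r.
    - apply csum_ext_in. intros i hi. now rewrite restrict_in; auto.
    - intros i hi; rewrite restrict_out; auto. now apply hA'. }
  rewrite e. apply hA.
  + apply NoDup_app; auto.
    * apply NoDup_filter, NoDup_nodup.
    * intros i hi hi'. apply hA' in hi'. now apply hi', h2.
  + intros i hi. apply in_or_app. destruct (excluded_middle_informative (D i)) as [d|d].
    * left. apply h3. rewrite filter_In, decb_true; auto.
    * right. now apply hA'.
Qed.

(** Cauchy criterion: two finite sets containing the set [A] of [summable_tail] have sums that
    differ by two tails, each at most [eps / 3]. *)
Lemma summable_hsum {I : Type} (x : I -> C) : summable x -> exists s, hsum x s.
Proof.
intros hx.
destruct (proj1 (@filterlim_locally_cauchy (list I) C_CompleteNormedModule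
   (finite_subsets (fun _ => True)) _ (csum x))) as [s hs].
- intros eps. destruct (summable_tail x hx (eps / 3)%R) as (A & hA & h).
  { assert (h := cond_pos eps); lra. }
  exists (fun B => NoDup B /\ incl A B). split.
  + exists A. split; auto.
  + intros B1 B2 [h1 h2] [h3 h4].
    apply C_NormedModule_mixin_compat1. change (Cmod (csum x B2 - csum x B1) < eps)%R.
    rewrite (csum_perm x _ _ (outside_permutation A B1 hA h1 h2)).
    rewrite (csum_perm x _ _ (outside_permutation A B2 hA h3 h4)).
    rewrite !csum_app.
    replace (csum x A + csum x (outside A B2) - (csum x A + csum x (outside A B1)))
      with (csum x (outside A B2) + - csum x (outside A B1)) by ring.
    eapply Rle_lt_trans; [apply Cmod_triangle|]. rewrite Cmod_opp.
    assert (forall B, NoDup B -> Cmod (csum x (outside A B)) <= eps / 3)%R as hB.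
    { intros B hB. eapply Rle_trans; [apply Cmod_csum|]. apply h.
      - now apply NoDup_filter.
      - intros i hi; now apply in_outside in hi. }
    assert (hp := cond_pos eps). assert (hB1 := hB B1 h1). assert (hB2 := hB B2 h3). lra.
- exists s. apply (has_sum_restrict (fun _ => True) x s) in hs.
  eapply hsum_ext; [|exact hs]. intros i; now apply restrict_in.
Qed.

(** Split [B] by the sign of [w]: the sum of absolute values is a difference of two subsums. *)
Lemma rsum_abs_le {I : Type} (w : I -> R) (B : list I) (M : R) :
  (forall p : I -> bool, Rabs (rsum w (filter p B)) <= M)%R ->
  (rsum (fun i => Rabs (w i)) B <= 2 * M)%R.
Proof.
intros h.
set (p := fun i => decb (0 <= w i)%R).
rewrite (rsum_perm _ _ _ (filter_permutation p B)), rsum_app.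
assert (h1 := h p). assert (h2 := h (fun i => negb (p i))).
assert (e1 : rsum (fun i => Rabs (w i)) (filter p B) = rsum w (filter p B)).
{ unfold rsum; f_equal. apply map_ext_in. intros i hi.
  apply filter_In in hi; destruct hi as [_ hi]. apply (proj1 (decb_true _)) in hi. now apply Rabs_pos_eq. }
assert (e2 : rsum (fun i => Rabs (w i)) (filter (fun i => negb (p i)) B) =
             (- rsum w (filter (fun i => negb (p i)) B))%R).
{ replace (- rsum w (filter (fun i => negb (p i)) B))%R
    with (rsum (fun i => -1 * w i)%R (filter (fun i => negb (p i)) B)) by (rewrite rsum_scal; ring).
  unfold rsum; f_equal. apply map_ext_in. intros i hi.
  apply filter_In in hi; destruct hi as [_ hi].
  apply Bool.negb_true_iff in hi; apply (proj1 (decb_false _)) in hi. rewrite Rabs_left; lra. }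
rewrite e1, e2.
assert (h3 := Rle_abs (rsum w (filter p B))).
assert (h4 := Rle_abs (- rsum w (filter (fun i => negb (p i)) B))).
rewrite Rabs_Ropp in h4. lra.
Qed.

(** Finite sums over sets containing a suitable [A] are within 1 of [s], so any finite sum disjoint
    from [A] has modulus at most 2. This holds for all its subsums too, so splitting by sign bounds
    the absolute real parts by 4, likewise the imaginary parts, and the moduli by 8. *)
Lemma hsum_summable {I : Type} (x : I -> C) s : hsum x s -> summable x.
Proof.
intros hs. destruct (hs 1%R Rlt_0_1) as [A0 hA0].
set (A := nodup ceq_dec A0).
assert (hA : NoDup A) by apply NoDup_nodup.
assert (h : forall B, NoDup B -> incl A B -> (Cmod (csum x B - s) < 1)%R).
{ intros B h1 h2; apply hA0; auto. intros i hi; apply h2. now apply nodup_In. }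
clearbody A; clear hA0.
assert (h2 : forall B, NoDup B -> (forall i, In i B -> ~ In i A) -> (Cmod (csum x B) <= 2)%R).
{ intros B hB hd.
  assert (h1 : (Cmod (csum x (A ++ B) - s) < 1)%R).
  { apply h; [apply NoDup_app; auto; intros i hi hi'; exact (hd i hi' hi)|].
    intros i hi; apply in_or_app; auto. }
  assert (h3 := h A hA (fun i hi => hi)). rewrite csum_app in h1.
  assert (h4 := Cmod_triangle (csum x A + csum x B - s) (- (csum x A - s))).
  replace (csum x A + csum x B - s + - (csum x A - s)) with (csum x B) in h4 by ring.
  rewrite Cmod_opp in h4. lra. }
assert (h3 : forall B, NoDup B -> (forall i, In i B -> ~ In i A) ->
   (rsum (fun i => Cmod (x i)) B <= 8)%R).
{ intros B hB hd.
  assert (hf : forall p : I -> bool, (Cmod (csum x (filter p B)) <= 2)%R).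
  { intros p. apply h2; [now apply NoDup_filter|]. intros i hi; apply filter_In in hi. now apply hd. }
  assert (hm : forall z : C, (Cmod z <= Rabs (fst z) + Rabs (snd z))%R).
  { intros [a b]. simpl.
    assert (e : (a, b) = RtoC a + Ci * RtoC b)
      by (unfold Ci, RtoC, Cmult, Cplus; simpl; f_equal; ring).
    rewrite e. eapply Rle_trans; [apply Cmod_triangle|].
    rewrite Cmod_mult, Cmod_Ci, !Cmod_R. lra. }
  eapply Rle_trans; [apply rsum_le; intros i _; apply hm|]. rewrite rsum_plus.
  assert (rsum (fun i => Rabs (fst (x i))) B <= 2 * 2)%R.
  { apply rsum_abs_le. intros p. rewrite <- fst_csum.
    eapply Rle_trans; [|apply (hf p)]. eapply Rle_trans; [|apply Rmax_Cmod]. apply Rmax_l. }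
  assert (rsum (fun i => Rabs (snd (x i))) B <= 2 * 2)%R.
  { apply rsum_abs_le. intros p. rewrite <- snd_csum.
    eapply Rle_trans; [|apply (hf p)]. eapply Rle_trans; [|apply Rmax_Cmod]. apply Rmax_r. }
  lra. }
exists (rsum (fun i => Cmod (x i)) A + 8)%R. intros B hB.
rewrite (rsum_perm _ _ _ (filter_permutation (fun i => decb (In i A)) B)), rsum_app.
apply Rplus_le_compat.
- apply rsum_incl; [intros; apply Cmod_ge_0|now apply NoDup_filter|].
  intros i hi. apply filter_In in hi. now apply (decb_true (In i A)).
- apply h3; [now apply NoDup_filter|]. intros i hi. now apply in_outside in hi.
Qed.

Lemma csum_hsum {I J : Type} (x : J -> I -> C) (s : J -> C) B :
  (forall j, In j B -> hsum (x j) (s j)) ->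
  hsum (fun i => csum (fun j => x j i) B) (csum s B).
Proof.
induction B as [|b B IH]; intros h; [apply hsum_zero|].
apply (hsum_plus (x b) (fun i => csum (fun j => x j i) B)); [apply h; now left|].
apply IH. intros; apply h; now right.
Qed.

(** Turns [summable_tail] into an estimate of a sum: [y] is meant as the error of an approximation
    that is exact on [A]. *)
Lemma hsum_tail_bound {I : Type} (x y : I -> C) (A : list I) (eps : R) s :
  (forall B, NoDup B -> (forall i, In i B -> ~ In i A) ->
     (rsum (fun i => Cmod (x i)) B <= eps)%R) ->
  (forall i, In i A -> y i = 0) -> (forall i, Cmod (y i) <= Cmod (x i))%R ->
  hsum y s -> (Cmod s <= eps)%R.
Proof.
intros hx hy hyx. apply hsum_bound. intros L hL.
rewrite (rsum_perm _ _ _ (filter_permutation (fun i => decb (In i A)) L)), rsum_app.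
fold (inside A L); fold (outside A L).
assert (e1 : (rsum (fun i => Cmod (y i)) (inside A L) <= rsum (fun i => 0 * Cmod (y i)) (inside A L))%R).
{ apply rsum_le. intros i hi. apply in_inside in hi. rewrite hy, Cmod_0 by tauto. lra. }
rewrite rsum_scal in e1.
assert (e2 : (rsum (fun i => Cmod (y i)) (outside A L) <= eps)%R).
{ eapply Rle_trans; [apply rsum_le; intros i _; apply hyx|]. apply hx.
  - now apply NoDup_filter.
  - intros i hi; now apply in_outside in hi. }
lra.
Qed.

(** For finite [B] containing the second coordinates of [A], [csum phi B] is the sum of [x] over all
    pairs lying above [B]. It differs from [s] by a sum over pairs that avoid [A], which is a
    tail. *)
Lemma hsum_fubini {I J : Type} (x : I * J -> C) (phi : J -> C) s :
  hsum x s -> (forall j, hsum (fun i => x (i, j)) (phi j)) -> hsum phi s.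
Proof.
intros hs hphi eps he.
destruct (summable_tail x (hsum_summable x s hs) (eps / 2)%R) as (A & hA & h); [lra|].
exists (map snd A). intros B hB hAB.
assert (hB' : hsum (fun p => csum (fun j => restrict (fun p => snd p = j) x p) B) (csum phi B)).
{ apply csum_hsum. intros j _.
  apply (hsum_inj (fun i => (i, j))).
  - intros i i' e; now injection e.
  - intros [i j']. destruct (excluded_middle_informative (j' = j)) as [->|n].
    + left; now exists i.
    + right; now apply restrict_out.
  - eapply hsum_ext; [|apply hphi]. intros i; symmetry; now apply restrict_in. }
assert (hin : forall p, In (snd p) B -> csum (fun j => restrict (fun p => snd p = j) x p) B = x p).
{ intros p hp. destruct (in_split _ _ hp) as (B1 & B2 & e). rewrite e in hB |- *.
  apply NoDup_remove_2 in hB.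
  rewrite csum_app, csum_cons, restrict_in by easy.
  rewrite !csum_zero; [ring| |]; intros j hj; apply restrict_out; intros e'; subst j;
    apply hB, in_or_app; auto. }
assert (hout : forall p, ~ In (snd p) B -> csum (fun j => restrict (fun p => snd p = j) x p) B = 0).
{ intros p hp. apply csum_zero. intros j hj. apply restrict_out. intros e; subst j; tauto. }
assert (hd := hsum_minus _ _ _ _ hB' hs).
apply Rle_lt_trans with (eps / 2)%R; [|lra].
revert hd; apply hsum_tail_bound with (1 := h).
- intros p hp. rewrite hin; [ring|]. apply hAB, in_map, hp.
- intros p. destruct (excluded_middle_informative (In (snd p) B)) as [hp|hp].
  + rewrite hin by easy. replace (x p - x p) with (RtoC 0) by ring.
    rewrite Cmod_0; apply Cmod_ge_0.
  + rewrite hout by easy. replace (0 - x p) with (- x p) by ring. rewrite Cmod_opp; lra.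
Qed.

(** * Exponentials and trigonometric series *)

Lemma Cexp_plus (a b : C) : Cexp (a + b) = Cexp a * Cexp b.
Proof.
destruct a as [a1 a2], b as [b1 b2]; unfold Cexp, Cmult; simpl.
rewrite exp_plus, cos_plus, sin_plus. f_equal; ring.
Qed.

Lemma ee_plus (a b : C) : ee (a + b) = ee a * ee b.
Proof. unfold ee. rewrite <- Cexp_plus. f_equal; ring. Qed.

Lemma ee_0 : ee 0 = 1.
Proof.
unfold ee, Cexp. replace (2 * PI * Ci * 0) with (RtoC 0) by ring. simpl.
now rewrite exp_0, cos_0, sin_0, Rmult_1_r, Rmult_0_r.
Qed.

Lemma ee_neq_0 (a : C) : ee a <> 0.
Proof.
intros h. assert (e := ee_plus a (- a)). rewrite h in e.
replace (a + - a) with (RtoC 0) in e by ring. rewrite ee_0 in e.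
apply C1_nz. rewrite e; ring.
Qed.

Lemma ee_explicit (a : C) :
  ee a = ((exp (- (2 * PI * Im a)) * cos (2 * PI * Re a))%R,
          (exp (- (2 * PI * Im a)) * sin (2 * PI * Re a))%R).
Proof.
unfold ee, Cexp. destruct a as [a1 a2].
replace (2 * PI * Ci * (a1, a2)) with ((- (2 * PI * a2))%R, (2 * PI * a1)%R); [easy|].
unfold Ci, RtoC, Cmult; simpl; f_equal; ring.
Qed.

Lemma Cmod_ee (a : C) : Cmod (ee a) = exp (- (2 * PI * Im a)).
Proof.
rewrite ee_explicit. set (E := exp _). set (t := (2 * PI * Re a)%R).
unfold Cmod; simpl.
replace (E * cos t * (E * cos t * 1) + E * sin t * (E * sin t * 1))%R with (E ^ 2 * (Rsqr (sin t) + Rsqr (cos t)))%R by (unfold Rsqr; ring).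
rewrite sin2_cos2, Rmult_1_r. apply sqrt_pow2, Rlt_le, exp_pos.
Qed.

Lemma ee_1 : ee 1 = 1.
Proof.
rewrite ee_explicit; simpl. rewrite Rmult_0_r, Ropp_0, exp_0, !Rmult_1_r, cos_2PI, sin_2PI.
unfold RtoC; f_equal; ring.
Qed.

Lemma ee_half : ee (/ 2)%R = - (1).
Proof.
rewrite ee_explicit; simpl. rewrite Rmult_0_r, Ropp_0, exp_0.
replace (2 * PI * / 2)%R with PI by field. rewrite cos_PI, sin_PI.
unfold RtoC, Copp; simpl; f_equal; ring.
Qed.

Lemma ee_IZR (p : Z) : ee (IZR p) = 1.
Proof.
assert (h : forall n : nat, ee (INR n) = 1).
{ induction n as [|n IH]; [apply ee_0|].
  rewrite S_INR, RtoC_plus, ee_plus, IH, ee_1; ring. }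
destruct (Z_le_dec 0 p) as [hp|hp].
- rewrite <- (Z2Nat.id p), <- INR_IZR_INZ by lia. apply h.
- assert (e := ee_plus (IZR p) (INR (Z.to_nat (- p)))).
  rewrite h, INR_IZR_INZ, Z2Nat.id, opp_IZR, <- RtoC_plus, Rplus_opp_r, ee_0 in e by lia.
  rewrite e; ring.
Qed.

(* Averaging over [z] and [z + / 2 ^ (k + 1)] kills the frequencies whose
   distance to [s] is an odd multiple of [2 ^ k]. *)
Lemma trigonometric_series_halving (a : Z -> C) (s : Z) (k : nat) :
  (forall z : C, hsum (fun r => a r * ee (IZR r * z)) 0) ->
  forall z : C, hsum (restrict (fun r => Z.divide (2 ^ Z.of_nat k) (r - s))
                        (fun r => a r * ee (IZR (r - s) * z))) 0.
Proof.
intros h. induction k as [|k IH]; intros z.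
- replace (RtoC 0) with (ee (- (IZR s * z)) * 0) by ring.
  eapply hsum_ext; [|apply hsum_scal, (h z)].
  intros r. rewrite restrict_in by apply Z.divide_1_l.
  rewrite minus_IZR, RtoC_minus.
  replace ((IZR r - IZR s) * z) with (IZR r * z + - (IZR s * z)) by ring.
  rewrite ee_plus; ring.
- set (w := (/ 2 ^ S k)%R).
  replace (RtoC 0) with ((/ 2)%R * (0 + 0)) by ring.
  eapply hsum_ext; [|apply hsum_scal, hsum_plus; [apply (IH z)|apply (IH (z + w))]].
  intros r; cbv beta.
  assert (hp : (2 ^ Z.of_nat (S k) = 2 * 2 ^ Z.of_nat k)%Z).
  { rewrite Nat2Z.inj_succ, Z.pow_succ_r; lia. }
  destruct (excluded_middle_informative (Z.divide (2 ^ Z.of_nat k) (r - s))) as [[q e]|n].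
  + assert (hd : Z.divide (2 ^ Z.of_nat k) (r - s)) by (now exists q).
    rewrite !(restrict_in (fun r => Z.divide (2 ^ Z.of_nat k) (r - s)) _ r hd).
    replace (IZR (r - s) * (z + w)) with (IZR (r - s) * z + (IZR (r - s) * w)%R)
      by (rewrite RtoC_mult; ring).
    rewrite ee_plus.
    replace (IZR (r - s) * w)%R with (IZR q * / 2)%R.
    2:{ rewrite e, mult_IZR. unfold w. rewrite <- pow_IZR. simpl. field. apply pow_nonzero; lra. }
    destruct (Z.Even_or_Odd q) as [[p hq]|[p hq]].
    * rewrite restrict_in by (exists p; rewrite e, hp, hq; ring).
      rewrite hq, mult_IZR. replace (2 * IZR p * / 2)%R with (IZR p) by field.
      rewrite ee_IZR, RtoC_inv; try lra. field.
    * rewrite restrict_out.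
      2:{ intros [p' e']. rewrite e, hp, hq in e'.
          assert (0 < 2 ^ Z.of_nat k)%Z by (apply Z.pow_pos_nonneg; lia).
          assert (2 * p + 1 = 2 * p')%Z; [|lia].
          apply (Z.mul_reg_r _ _ (2 ^ Z.of_nat k)); [lia|rewrite e'; ring]. }
      rewrite hq, plus_IZR, mult_IZR.
      replace ((2 * IZR p + 1) * / 2)%R with (IZR p + / 2)%R by field.
      rewrite RtoC_plus, ee_plus, ee_IZR, ee_half; ring.
  + rewrite !(restrict_out (fun r => Z.divide (2 ^ Z.of_nat k) (r - s)) _ r n).
    rewrite restrict_out; [ring|]. intros [q e]; apply n. exists (2 * q)%Z. rewrite e, hp; ring.
Qed.

Lemma hsum_single {I : Type} (x : I -> C) (i : I) : hsum (restrict (fun j => j = i) x) (x i).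
Proof.
intros eps he. exists (i :: nil). intros B hB hi.
destruct (in_split i B) as (B1 & B2 & ->); [apply hi; now left|].
apply NoDup_remove_2 in hB.
rewrite csum_app, csum_cons, restrict_in, !csum_zero by
  (try easy; intros j hj; apply restrict_out; intros ->; apply hB, in_or_app; auto).
replace (0 + (x i + 0) - x i) with (RtoC 0) by ring. now rewrite Cmod_0.
Qed.

(** After [k] halvings the series at [z = 0] consists of [a s] and of the [a r] with [r - s] a
    nonzero multiple of [2^k]. For large [k] all such [r] lie outside the finite set [A], so [a s]
    is bounded by a tail. Absolute summability of [a] is the case [z = 0] of the hypothesis. *)
Lemma trigonometric_series_unique (a : Z -> C) :
  (forall z : C, hsum (fun r => a r * ee (IZR r * z)) 0) -> forall s, a s = 0.
Proof.
intros h s. apply Cmod_eq_0, Rle_antisym; [|apply Cmod_ge_0].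
apply le_epsilon; intros eps he; rewrite Rplus_0_l.
assert (ha : summable a).
{ apply summable_ext with (fun r => a r * ee (IZR r * 0)).
  - intros r. rewrite Cmult_0_r, ee_0; ring.
  - apply hsum_summable with (1 := h 0). }
destruct (summable_tail a ha eps he) as (A & _ & hA).
assert (hk : exists k : nat, forall r, In r A -> (Z.abs (r - s) < 2 ^ Z.of_nat k)%Z).
{ clear. induction A as [|r A [k hk]]; [now exists 0%nat|].
  exists (k + Z.to_nat (Z.abs (r - s)))%nat.
  assert (h1 : (Z.of_nat k <= Z.of_nat (k + Z.to_nat (Z.abs (r - s))))%Z) by lia.
  intros r' [<-|hr].
  - eapply Z.lt_le_trans; [apply (Z.pow_gt_lin_r 2); lia|]. apply Z.pow_le_mono_r; lia.
  - eapply Z.lt_le_trans; [now apply hk|]. apply Z.pow_le_mono_r; lia. }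
destruct hk as [k hk].
assert (h0 := hsum_minus _ _ _ _ (hsum_single a s) (trigonometric_series_halving a s k h 0)).
replace (a s - 0) with (a s) in h0 by ring.
revert h0; apply hsum_tail_bound with (1 := hA); intros r.
- intros hr. specialize (hk r hr).
  destruct (Z.eq_dec r s) as [->|n].
  + rewrite !restrict_in; try easy; [rewrite Cmult_0_r, ee_0; ring|].
    rewrite Z.sub_diag; apply Z.divide_0_r.
  + rewrite !restrict_out; [ring| |easy].
    intros hd. apply Z.divide_abs_r, Z.divide_pos_le in hd; lia.
- destruct (Z.eq_dec r s) as [->|n].
  + rewrite !restrict_in; try easy; [|rewrite Z.sub_diag; apply Z.divide_0_r].
    rewrite Cmult_0_r, ee_0. replace (a s - a s * 1) with (RtoC 0) by ring.
    rewrite Cmod_0. apply Cmod_ge_0.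
  + rewrite (restrict_out (fun j => j = s)) by easy.
    unfold restrict; destruct excluded_middle_informative.
    * rewrite Cmult_0_r, ee_0. replace (0 - a r * 1) with (- a r) by ring. rewrite Cmod_opp; lra.
    * replace (0 - 0) with (RtoC 0) by ring. rewrite Cmod_0. apply Cmod_ge_0.
Qed.

(** * Derivatives *)

(* [C_derive] only sees the restriction of a function to a horizontal line. *)
Definition is_hderive (f : C -> C) (z l : C) : Prop :=
  is_derive (fun x : R => Re (f (x, Im z))) (Re z) (Re l) /\
  is_derive (fun x : R => Im (f (x, Im z))) (Re z) (Im l).

Lemma is_derive_lim (g : R -> R) (x l : R) :
  is_derive g x l -> is_lim (fun y => ((g y - g x) / (y - x))%R) x l.
Proof.
intros h. apply is_derive_Reals in h. apply is_lim_spec. intros eps.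
destruct (h eps (cond_pos eps)) as [d hd]. exists d. intros y hy hn.
assert (e : (x + (y - x))%R = y :> R) by (simpl; ring).
specialize (hd (y - x)%R). rewrite e in hd.
apply hd; [lra|exact hy].
Qed.

Lemma is_hderive_unique (f : C -> C) (z l : C) : is_hderive f z l -> C_derive f z = l.
Proof.
intros [h1 h2]. destruct z as [x y], l as [l1 l2]; simpl in *.
unfold C_derive, C_lim; cbn [fst snd].
apply is_derive_lim in h1. apply is_derive_lim in h2.
assert (e : forall t : R, t <> x ->
  (f (t, y) - f (x, y)) / ((t, y) - (x, y)) =
  (((Re (f (t, y)) - Re (f (x, y))) / (t - x))%R, ((Im (f (t, y)) - Im (f (x, y))) / (t - x))%R)).
{ intros t ht. replace ((t, y) - (x, y)) with (RtoC (t - x))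
    by (unfold RtoC, Cminus, Copp, Cplus; simpl; f_equal; ring).
  unfold Cdiv. rewrite <- RtoC_inv by lra.
  destruct (f (t, y)), (f (x, y)). unfold RtoC, Cminus, Copp, Cplus, Cmult, Rdiv; simpl.
  f_equal; ring. }
f_equal.
- erewrite is_lim_unique; [|eapply is_lim_ext_loc; [|exact h1]]; [easy|].
  exists (mkposreal _ Rlt_0_1). intros t _ ht. now rewrite (e t ht).
- erewrite is_lim_unique; [|eapply is_lim_ext_loc; [|exact h2]]; [easy|].
  exists (mkposreal _ Rlt_0_1). intros t _ ht. now rewrite (e t ht).
Qed.

Lemma is_hderive_ext (f g : C -> C) (z l : C) :
  (forall w, Im w = Im z -> f w = g w) -> is_hderive f z l -> is_hderive g z l.
Proof.
intros e [h1 h2]; split; (eapply is_derive_ext; [|eassumption]); intros t; simpl; now rewrite e.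
Qed.

Lemma is_hderive_const (c z : C) : is_hderive (fun _ => c) z 0.
Proof. split; apply (is_derive_const (V := R_NormedModule)). Qed.

Lemma is_hderive_plus (f g : C -> C) (z a b : C) :
  is_hderive f z a -> is_hderive g z b -> is_hderive (fun w => f w + g w) z (a + b).
Proof.
intros [h1 h2] [h3 h4]; split; now apply (is_derive_plus (V := R_NormedModule)).
Qed.

Lemma is_hderive_mult (f g : C -> C) (z a b : C) :
  is_hderive f z a -> is_hderive g z b ->
  is_hderive (fun w => f w * g w) z (a * g z + f z * b).
Proof.
intros [h1 h2] [h3 h4].
assert (hm := fun u v du dv (hu : is_derive u (Re z) du) (hv : is_derive v (Re z) dv) =>
  is_derive_mult (K := R_AbsRing) u v (Re z) du dv hu hv Rmult_comm).
destruct z as [x y]; simpl in *. split.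
- assert (h := is_derive_minus (V := R_NormedModule) _ _ _ _ _ (hm _ _ _ _ h1 h3) (hm _ _ _ _ h2 h4)).
  evar_last; [exact h|]. simpl. unfold minus, plus, opp, mult; simpl. unfold Re, Im; simpl. ring.
- assert (h := is_derive_plus (V := R_NormedModule) _ _ _ _ _ (hm _ _ _ _ h1 h4) (hm _ _ _ _ h2 h3)).
  evar_last; [exact h|]. simpl. unfold minus, plus, opp, mult; simpl. unfold Re, Im; simpl. ring.
Qed.

Lemma is_hderive_scal (c : C) (f : C -> C) (z l : C) :
  is_hderive f z l -> is_hderive (fun w => c * f w) z (c * l).
Proof.
intros h. assert (h' := is_hderive_mult _ _ _ _ _ (is_hderive_const c z) h). simpl in h'.
now replace (0 * f z + c * l) with (c * l) in h' by ring.
Qed.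

Lemma is_hderive_sum (f : nat -> C -> C) (z : C) (l : nat -> C) (a b : nat) :
  (forall i, (a <= i <= b)%nat -> is_hderive (f i) z (l i)) ->
  is_hderive (fun w => sum_n_m (G := C_AbelianGroup) (fun i => f i w) a b) z
             (sum_n_m (G := C_AbelianGroup) l a b).
Proof.
intros h. destruct (Nat.le_gt_cases a b) as [hab|hab].
- induction b as [|b IH].
  + replace a with 0%nat in * by lia. rewrite sum_n_n.
    apply is_hderive_ext with (f 0%nat); [intros; now rewrite sum_n_n|]. apply h; lia.
  + destruct (Nat.eq_dec a (S b)) as [->|n].
    * rewrite sum_n_n. apply is_hderive_ext with (f (S b)); [intros; now rewrite sum_n_n|]. apply h; lia.
    * rewrite sum_n_Sm by lia.
      apply is_hderive_ext with
        (fun w => sum_n_m (G := C_AbelianGroup) (fun i => f i w) a b + f (S b) w);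
        [intros; rewrite sum_n_Sm by lia; reflexivity|].
      apply is_hderive_plus; [apply IH; [intros; apply h|]|apply h]; lia.
- rewrite sum_n_m_zero by lia.
  apply is_hderive_ext with (fun _ => 0); [intros; now rewrite sum_n_m_zero by lia|].
  apply is_hderive_const.
Qed.

(** * Termwise differentiation of exponential series *)

Lemma is_derive_quadratic_bound (g : R -> R) (x l M : R) :
  (forall h, Rabs (g (x + h) - g x - h * l) <= M * h ^ 2)%R -> is_derive g x l.
Proof.
intros hM. apply is_derive_Reals. intros eps he.
assert (hp : (0 < Rabs M + 1)%R) by (assert (h := Rabs_pos M); lra).
assert (hd : (0 < eps / (Rabs M + 1))%R) by now apply Rdiv_lt_0_compat.
exists (mkposreal _ hd). simpl. intros h h0 hh.
replace ((g (x + h) - g x) / h - l)%R with ((g (x + h) - g x - h * l) / h)%R by now field.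
assert (h1 : (0 < Rabs h)%R) by now apply Rabs_pos_lt.
rewrite Rabs_div by easy. apply Rmult_lt_reg_r with (Rabs h); auto.
replace (Rabs (g (x + h) - g x - h * l) / Rabs h * Rabs h)%R
  with (Rabs (g (x + h) - g x - h * l))%R by (field; lra).
eapply Rle_lt_trans; [apply hM|].
apply Rmult_lt_compat_r with (r := (Rabs M + 1)%R) in hh; auto.
replace (eps / (Rabs M + 1) * (Rabs M + 1))%R with eps in hh by (field; lra).
rewrite <- pow2_abs. assert (h2 := Rle_abs M). nra.
Qed.

(** A criterion suited to series: quadratic error bounds valid for every real increment add up term
    by term. *)
Lemma is_hderive_quadratic_bound (f : C -> C) (z l : C) (M : R) :
  (forall h : R, (Cmod (f (z + h)%C - f z - h * l)%C <= M * h ^ 2)%R) -> is_hderive f z l.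
Proof.
intros hM. destruct z as [x y].
split; apply is_derive_quadratic_bound with M; intros h; (eapply Rle_trans; [|apply (hM h)]);
  (eapply Rle_trans; [|apply Rmax_Cmod]); simpl;
  replace ((x, y) + h) with ((x + h)%R, y)
    by (unfold RtoC, Cplus; simpl; f_equal; ring);
  [eapply Rle_trans; [|apply Rmax_l]|eapply Rle_trans; [|apply Rmax_r]];
  right; f_equal; simpl; unfold Re, Im; ring.
Qed.

Lemma Rabs_sin_le (x : R) : (Rabs (sin x) <= Rabs x)%R.
Proof.
destruct (MVT_gen sin 0 x cos) as (c & _ & e).
- intros; apply is_derive_sin.
- intros; apply continuity_sin.
- rewrite sin_0, !Rminus_0_r in e. rewrite e, Rabs_mult.
  assert (Rabs (cos c) <= 1)%R by (apply Rabs_le; apply COS_bound).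
  assert (h := Rabs_pos x). nra.
Qed.

Lemma Rabs_cos_1_le (x : R) : (Rabs (cos x - 1) <= Rabs x)%R.
Proof.
destruct (MVT_gen cos 0 x (fun t => - sin t)%R) as (c & _ & e).
- intros; apply is_derive_cos.
- intros; apply continuity_cos.
- rewrite cos_0, Rminus_0_r in e. rewrite e, Rabs_mult, Rabs_Ropp.
  assert (Rabs (sin c) <= 1)%R by (apply Rabs_le; apply SIN_bound).
  assert (h := Rabs_pos x). nra.
Qed.

Lemma Rabs_between_0 (x c : R) : (Rmin 0 x <= c <= Rmax 0 x)%R -> (Rabs c <= Rabs x)%R.
Proof.
unfold Rmin, Rmax; intros h.
destruct (Rle_dec 0 x); [rewrite !Rabs_pos_eq|rewrite !Rabs_left1]; lra.
Qed.

(** With [t = 2 PI u] the two parts of the error are [cos t - 1] and [sin t - t]. The mean value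
    theorem bounds each by [t^2], whence the factor 2. *)
Lemma Cmod_ee_taylor (u : R) : (Cmod (ee u - 1 - 2 * PI * Ci * u) <= 2 * (2 * PI * u) ^ 2)%R.
Proof.
set (t := (2 * PI * u)%R).
assert (hs : (Rabs (sin t - t) <= t ^ 2)%R).
{ destruct (MVT_gen (fun t => sin t - t)%R 0 t (fun t => cos t - 1)%R) as (c & hc & e).
  - intros; auto_derive; auto; ring.
  - intros; apply continuity_pt_minus; [apply continuity_sin|apply derivable_continuous, derivable_id].
  - rewrite sin_0, !Rminus_0_r in e. rewrite e, Rabs_mult, <- pow2_abs.
    assert (h := Rabs_cos_1_le c). assert (h' := Rabs_between_0 _ _ hc).
    assert (h3 := Rabs_pos t). nra. }
assert (hc : (Rabs (cos t - 1) <= t ^ 2)%R).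
{ destruct (MVT_gen cos 0 t (fun t => - sin t)%R) as (c & hc & e).
  - intros; apply is_derive_cos.
  - intros; apply continuity_cos.
  - rewrite cos_0, !Rminus_0_r in e. rewrite e, Rabs_mult, Rabs_Ropp, <- pow2_abs.
    assert (h := Rabs_sin_le c). assert (h' := Rabs_between_0 _ _ hc).
    assert (h3 := Rabs_pos t). nra. }
rewrite ee_explicit; simpl Re; simpl Im.
rewrite Rmult_0_r, Ropp_0, exp_0, !Rmult_1_l. fold t.
replace (Cminus (Cminus (cos t, sin t) 1) (2 * PI * Ci * u))
  with (RtoC (cos t - 1) + Ci * RtoC (sin t - t))
  by (apply injective_projections; unfold t; simpl; ring).
eapply Rle_trans; [apply Cmod_triangle|]. rewrite Cmod_mult, Cmod_Ci, !Cmod_R. lra.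
Qed.

(** For real [h], [ee (lam i * (z + h))] factors through [ee (lam i * h)], so by [Cmod_ee_taylor]
    the [i]-th error is at most [8 PI^2 h^2 lam_i^2] times the modulus of the [i]-th term.
    Summability with weight [lam^2] thus controls the whole error, and also gives weight [lam],
    since [|lam| <= 1 + lam^2]. *)
Lemma hsum_hderive {I : Type} (a : I -> C) (lam : I -> R) (F : C -> C) (z : C) :
  (forall w, Im w = Im z -> hsum (fun i => a i * ee (lam i * w)) (F w)) ->
  summable (fun i => (lam i ^ 2)%R * (a i * ee (lam i * z))) ->
  exists l, hsum (fun i => 2 * PI * Ci * lam i * (a i * ee (lam i * z))) l /\ is_hderive F z l.
Proof.
intros hF h2. assert (h0 := hsum_summable _ _ (hF z eq_refl)).
destruct (summable_hsum (fun i => 2 * PI * Ci * lam i * (a i * ee (lam i * z)))) as [l hl].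
{ apply summable_ext with (fun i => 2 * PI * Ci * (lam i * (a i * ee (lam i * z)))); [intros; ring|].
  apply summable_scal.
  set (x := fun i => a i * ee (lam i * z)).
  destruct (h0) as [M0 hM0], h2 as [M2 hM2].
  exists (M0 + M2)%R. intros A hA.
  eapply Rle_trans; [|apply Rplus_le_compat; [apply (hM0 A hA)|apply (hM2 A hA)]].
  rewrite <- rsum_plus. apply rsum_le. intros i _.
  rewrite !(Cmod_mult (RtoC _)), !Cmod_R.
  fold (x i). assert (h := Cmod_ge_0 (x i)).
  rewrite (Rabs_pos_eq (lam i ^ 2)) by apply pow2_ge_0. rewrite <- pow2_abs.
  assert (h' := Rabs_pos (lam i)). assert (0 <= (Rabs (lam i) - 1) ^ 2)%R by apply pow2_ge_0. nra. }
exists l; split; auto.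
destruct h2 as [M hM].
apply is_hderive_quadratic_bound with (8 * PI ^ 2 * M)%R. intros h.
assert (hz : Im (z + h) = Im z) by (destruct z; simpl; ring).
assert (hs := hsum_minus _ _ _ _ (hsum_minus _ _ _ _ (hF (z + h) hz) (hF z eq_refl)) (hsum_scal h _ _ hl)).
revert hs; apply hsum_bound. intros A hA. cbv beta.
apply Rle_trans with (rsum (fun i => 8 * PI ^ 2 * h ^ 2 * Cmod ((lam i ^ 2)%R * (a i * ee (lam i * z))))%R A).
- apply rsum_le. intros i _.
  replace (a i * ee (lam i * (z + h)) - a i * ee (lam i * z) -
           h * (2 * PI * Ci * lam i * (a i * ee (lam i * z))))
    with ((a i * ee (lam i * z)) * (ee (lam i * h)%R - 1 - 2 * PI * Ci * (lam i * h)%R)).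
  2:{ replace (lam i * (z + h)) with (lam i * z + (lam i * h)%R) by (rewrite RtoC_mult; ring).
      rewrite ee_plus, RtoC_mult. ring. }
  rewrite (Cmod_mult (a i * _)), (Cmod_mult (RtoC _)), Cmod_R, (Rabs_pos_eq (lam i ^ 2)) by apply pow2_ge_0.
  assert (h1 := Cmod_ee_taylor (lam i * h)). assert (h3 := Cmod_ge_0 (a i * ee (lam i * z))).
  eapply Rle_trans; [apply Rmult_le_compat_l; [exact h3|exact h1]|]. right; ring.
- rewrite rsum_scal.
  replace (8 * PI ^ 2 * M * h ^ 2)%R with (8 * PI ^ 2 * h ^ 2 * M)%R by ring.
  apply Rmult_le_compat_l; [|apply (hM A hA)].
  assert (h1 := pow2_ge_0 h). assert (h3 := pow2_ge_0 PI). nra.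
Qed.

(** * q-series *)

(** The exponents are arbitrary reals because those of a theta component are [n + kappa - r^2 / 4m];
    vanishing coefficients replace a restricted index set. *)
Definition qseries (h : C -> C) : Prop :=
  exists (a : Z -> C) (lam : Z -> R),
    (forall n, (lam n < 0)%R -> a n = 0) /\
    forall tau, upper tau -> hsum (fun n => a n * ee (lam n * tau)) (h tau).

(** The factor [lam] is absorbed by lowering [tau]: at [tau - i d] the term of exponent [lam] gains
    [exp (K lam)] with [K = 2 PI d], and [lam <= exp (K lam) / K]. Taking [d = Im tau / 2] stays in
    the upper half-plane. *)
Lemma qseries_summable (a : Z -> C) (lam : Z -> R) :
  (forall n, (lam n < 0)%R -> a n = 0) ->
  (forall tau, upper tau -> summable (fun n => a n * ee (lam n * tau))) ->
  forall tau, upper tau -> summable (fun n => lam n * a n * ee (lam n * tau)).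
Proof.
intros hl ha tau ht.
set (d := (Im tau / 2)%R). assert (hd : (0 < d)%R) by (unfold upper, d in *; lra).
assert (hpi := PI_RGT_0).
assert (hK : (0 < 2 * PI * d)%R) by (apply Rmult_lt_0_compat; lra).
apply summable_le with (2 := Rlt_le _ _ (Rinv_0_lt_compat _ hK)) (3 := ha (tau - Ci * d) ltac:(unfold upper, d in *; destruct tau; simpl in *; lra)).
intros n. destruct (Rlt_le_dec (lam n) 0) as [hn|hn].
- rewrite hl, Cmult_0_r, !Cmult_0_l, Cmod_0 by easy. lra.
- replace (lam n * (tau - Ci * d)) with (lam n * tau + - (Ci * (lam n * d)%R)) by (rewrite RtoC_mult; ring).
  rewrite ee_plus, !Cmod_mult, Cmod_R, Rabs_pos_eq by easy.
  rewrite (Cmod_ee (- _)).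
  replace (- (2 * PI * Im (- (Ci * (lam n * d)%R))))%R with (2 * PI * d * lam n)%R by (simpl; ring).
  set (x := (Cmod (a n) * Cmod (ee (lam n * tau)))%R).
  assert (hx : (0 <= x)%R) by (apply Rmult_le_pos; apply Cmod_ge_0).
  replace (Cmod (a n) * (Cmod (ee (lam n * tau)) * exp (2 * PI * d * lam n)))%R
    with (x * exp (2 * PI * d * lam n))%R by (unfold x; ring).
  replace (lam n * Cmod (a n) * Cmod (ee (lam n * tau)))%R with (lam n * x)%R by (unfold x; ring).
  apply Rmult_le_reg_l with (1 := hK). rewrite <- Rmult_assoc, <- Rmult_assoc, Rinv_r, Rmult_1_l by lra.
  assert (h := exp_ineq1_le (2 * PI * d * lam n)). nra.
Qed.

(** Two applications of [qseries_summable] provide the weight [lam^2] that [hsum_hderive]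
    requires. *)
Lemma qseries_Dtau (h : C -> C) : qseries h ->
  qseries (Dtau h) /\ forall tau, upper tau -> is_hderive h tau (2 * PI * Ci * Dtau h tau).
Proof.
intros (a & lam & hl & hs).
assert (h2pi : 2 * PI * Ci <> 0).
{ assert (hpi := PI_RGT_0). repeat apply Cmult_neq_0.
  - intros e; apply RtoC_inj in e; lra.
  - intros e; apply RtoC_inj in e; lra.
  - intros e; injection e; lra. }
assert (key : forall tau, upper tau ->
  hsum (fun n => lam n * a n * ee (lam n * tau)) (Dtau h tau) /\
  is_hderive h tau (2 * PI * Ci * Dtau h tau)).
{ intros tau ht. destruct (hsum_hderive a lam h tau) as (l & h1 & h2).
  - intros w hw. apply hs. unfold upper; now rewrite hw.
  - assert (h2 : summable (fun n => lam n * (lam n * a n) * ee (lam n * tau))).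
    { apply qseries_summable; auto.
      - intros n hn; rewrite hl by easy; ring.
      - intros t hu. apply qseries_summable; auto. intros t' hu'. apply hsum_summable with (1 := hs t' hu'). }
    revert h2; apply summable_ext. intros n; simpl. rewrite !RtoC_mult; ring.
  - unfold Dtau. rewrite (is_hderive_unique _ _ _ h2). split.
    + eapply hsum_ext; [|apply hsum_scal, h1]. intros n; simpl. field.
      repeat split; intros e; apply h2pi; rewrite e; ring.
    + replace (2 * PI * Ci * (/ (2 * PI * Ci) * l)) with l; [easy|]. field.
      repeat split; intros e; apply h2pi; rewrite e; ring. }
split.
- exists (fun n => lam n * a n), lam. split.
  + intros n hn; rewrite hl by easy; ring.
  + intros tau ht; now apply key.
- intros tau ht; now apply key.
Qed.

Lemma qseries_iter_Dtau (h : C -> C) (j : nat) : qseries h -> qseries (Nat.iter j Dtau h).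
Proof. intros hh; induction j as [|j IH]; [easy|]. now apply qseries_Dtau. Qed.

(** * Theta series *)

(** Comparison series for theta series: two geometric series of ratio [exp (-1)], with 0 counted in
    both. *)
Lemma summable_exp_Zabs : summable (fun r : Z => RtoC (exp (- Rabs (IZR r)))).
Proof.
set (q := exp (-1)).
assert (hq : (0 < q < 1)%R).
{ split; [apply exp_pos|]. rewrite <- exp_0. apply exp_increasing; lra. }
set (w := fun r : Z => Cmod (RtoC (exp (- Rabs (IZR r))))).
assert (hw : forall n : nat, w (Z.of_nat n) = (q ^ n)%R /\ w (- Z.of_nat n)%Z = (q ^ n)%R).
{ intros n. unfold w, q. rewrite !Cmod_R, !(Rabs_pos_eq (exp _)) by apply Rlt_le, exp_pos.
  rewrite opp_IZR, Rabs_Ropp, <- INR_IZR_INZ, Rabs_pos_eq by apply pos_INR.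
  rewrite <- Rpower_pow by apply exp_pos. unfold Rpower. rewrite ln_exp.
  split; f_equal; ring. }
assert (hg : forall N a, (rsum (fun n => q ^ n) (seq a N) * (1 - q) = q ^ a - q ^ (a + N))%R).
{ induction N as [|N IH]; intros a.
  - rewrite Nat.add_0_r; unfold rsum; simpl; ring.
  - change (rsum (fun n => q ^ n)%R (seq a (S N))) with (q ^ a + rsum (fun n => q ^ n) (seq (S a) N))%R.
    rewrite Rmult_plus_distr_r, IH. replace (S a + N)%nat with (a + S N)%nat by lia. simpl; ring. }
assert (hg' : forall N, (rsum (fun n => q ^ n) (seq 0 N) <= / (1 - q))%R).
{ intros N. apply Rmult_le_reg_r with (1 - q)%R; [lra|].
  rewrite hg, Rinv_l by lra. simpl (q ^ 0)%R.
  assert (0 < q ^ (0 + N))%R by (apply pow_lt; lra). lra. }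
exists (/ (1 - q) + / (1 - q))%R. intros A hA. fold w.
assert (hN : exists N : nat, forall r, In r A -> (Z.abs r < Z.of_nat N)%Z).
{ clear. induction A as [|r A [N hN]]; [now exists 0%nat|].
  exists (N + S (Z.to_nat (Z.abs r)))%nat. intros r' [<-|hr]; [lia|].
  specialize (hN r' hr); lia. }
destruct hN as [N hN].
apply Rle_trans with (rsum w (map Z.of_nat (seq 0 N) ++ map (fun n => (- Z.of_nat n)%Z) (seq 0 N))).
- apply rsum_incl; [intros; apply Cmod_ge_0|easy|].
  intros r hr. specialize (hN r hr). apply in_or_app.
  destruct (Z_le_dec 0 r).
  + left. apply in_map_iff. exists (Z.to_nat r). split; [lia|]. apply in_seq; lia.
  + right. apply in_map_iff. exists (Z.to_nat (- r)). split; [lia|]. apply in_seq; lia.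
- rewrite rsum_app, !rsum_map.
  apply Rplus_le_compat; (eapply Rle_trans; [|apply (hg' N)]); apply rsum_le; intros n _;
    right; apply hw.
Qed.

Definition theta_term (m : nat) (tau z : C) (r : Z) : C :=
  ee ((IZR r ^ 2 / (4 * INR m))%R * tau) * ee (IZR r * z).

Lemma theta_term_neq_0 m tau z r : theta_term m tau z r <> 0.
Proof. apply Cmult_neq_0; apply ee_neq_0. Qed.

(** With [x = |r|] and [x^j <= exp (j x)], the term is at most [exp (- al x^2 + (be - 1) x)].
    Completing the square, [- al x^2 + be x <= be^2 / (4 al)], leaves a constant times [exp (- x)].
    The weights [r^j] are the ones produced by differentiating in [tau] and in [z]. *)
Lemma summable_theta (m : nat) (tau z : C) (j : nat) (D : Z -> Prop) :
  (0 < m)%nat -> upper tau ->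
  summable (fun r => (IZR r ^ j)%R * restrict D (theta_term m tau z) r).
Proof.
intros hm ht. apply lt_0_INR in hm. unfold upper in ht. assert (hpi := PI_RGT_0).
set (al := (2 * PI * Im tau / (4 * INR m))%R).
set (be := (Rabs (2 * PI * Im z) + 1 + INR j)%R).
assert (hal : (0 < al)%R).
{ apply Rdiv_lt_0_compat; [apply Rmult_lt_0_compat|]; lra. }
apply summable_le with (2 := Rlt_le _ _ (exp_pos (be ^ 2 / (4 * al)))) (3 := summable_exp_Zabs).
intros r. rewrite Cmod_mult, !Cmod_R, (Rabs_pos_eq (exp _)), <- RPow_abs by apply Rlt_le, exp_pos.
set (x := Rabs (IZR r)). assert (hx : (0 <= x)%R) by apply Rabs_pos.
assert (hj : (x ^ j <= exp (INR j * x))%R).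
{ induction j as [|i IH].
  - simpl. rewrite Rmult_0_l, exp_0. lra.
  - rewrite S_INR, Rmult_plus_distr_r, exp_plus, Rmult_1_l, <- tech_pow_Rmult, Rmult_comm.
    apply Rmult_le_compat; auto; [now apply pow_le|].
    assert (h := exp_ineq1_le x). lra. }
assert (ht' : (Cmod (restrict D (theta_term m tau z) r) <= exp (- (al * x ^ 2) + Rabs (2 * PI * Im z) * x))%R).
{ destruct (excluded_middle_informative (D r)) as [d|d].
  2:{ rewrite restrict_out, Cmod_0 by easy. apply Rlt_le, exp_pos. }
  rewrite restrict_in by easy. unfold theta_term. rewrite Cmod_mult, !Cmod_ee, <- exp_plus.
  apply exp_monotone.
  apply Rplus_le_compat.
  - right. unfold al, x. rewrite pow2_abs. unfold Im; simpl. field; lra.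
  - replace (- (2 * PI * Im (IZR r * z)))%R with (- ((2 * PI * Im z) * IZR r))%R by (unfold Im; simpl; ring).
    unfold x. rewrite <- Rabs_mult, <- Rabs_Ropp. apply Rle_abs. }
eapply Rle_trans; [apply Rmult_le_compat; [now apply pow_le|apply Cmod_ge_0|exact hj|exact ht']|].
rewrite <- !exp_plus. apply exp_monotone.
apply Rplus_le_reg_l with (- (INR j * x + (- (al * x ^ 2) + Rabs (2 * PI * Im z) * x)))%R.
rewrite Rplus_opp_l.
replace (- (INR j * x + (- (al * x ^ 2) + Rabs (2 * PI * Im z) * x)) + (be ^ 2 / (4 * al) + - x))%R
  with ((2 * al * x - be) ^ 2 / (4 * al))%R by (unfold be; field; lra).
apply Rmult_le_pos; [apply pow2_ge_0|apply Rlt_le, Rinv_0_lt_compat; lra].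
Qed.

Definition theta_class (m mu : nat) (r : Z) : Prop :=
  Z.divide (2 * Z.of_nat m) (r - Z.of_nat mu).

Lemma hsum_theta (m mu : nat) (tau z : C) : (0 < m)%nat -> upper tau ->
  hsum (restrict (theta_class m mu) (theta_term m tau z)) (theta m mu tau z).
Proof.
intros hm ht.
destruct (summable_hsum (restrict (theta_class m mu) (theta_term m tau z))) as [s hs].
- eapply summable_ext; [|apply (summable_theta m tau z 0 (theta_class m mu) hm ht)].
  intros r; simpl; ring.
- replace (theta m mu tau z) with s; [easy|]. symmetry.
  apply has_sum_unique, has_sum_restrict, hs.
Qed.

(** Both [8 PI i m] times the [tau]-derivative and the second [z]-derivative multiply the [r]-th
    term by [(2 PI i r)^2]. The first [z]-derivative is given as a function, since it has to be
    differentiated again. *)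
Lemma theta_heat (m mu : nat) (tau z : C) : (0 < m)%nat -> upper tau ->
  exists (lt : C) (lz : C -> C) (lzz : C),
    is_hderive (fun t => theta m mu t z) tau lt /\
    (forall w, is_hderive (theta m mu tau) w (lz w)) /\
    is_hderive lz z lzz /\
    8 * PI * Ci * INR m * lt = lzz.
Proof.
intros hm ht. assert (hm' := lt_0_INR _ hm).
set (D := theta_class m mu).
destruct (hsum_hderive (fun r => restrict D (fun r => ee (IZR r * z)) r)
   (fun r => IZR r ^ 2 / (4 * INR m))%R (fun t => theta m mu t z) tau) as (lt & h1 & h2).
{ intros w hw. eapply hsum_ext; [|apply hsum_theta; auto; unfold upper; now rewrite hw].
  intros r. unfold D, restrict, theta_term. destruct excluded_middle_informative; ring. }
{ eapply summable_ext; [|apply summable_scal with (c := RtoC (/ (4 * INR m) ^ 2)),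
    (summable_theta m tau z 4 D hm ht)].
  intros r. unfold restrict, theta_term.
  destruct excluded_middle_informative; [|ring].
  rewrite Cmult_assoc, <- RtoC_mult.
  replace (/ (4 * INR m) ^ 2 * IZR r ^ 4)%R with ((IZR r ^ 2 / (4 * INR m)) ^ 2)%R by (field; lra).
  ring. }
assert (hz : forall w, exists l,
   hsum (fun r => 2 * PI * Ci * IZR r * restrict D (theta_term m tau w) r) l /\
   is_hderive (theta m mu tau) w l).
{ intros w.
  destruct (hsum_hderive (fun r => restrict D (fun r => ee ((IZR r ^ 2 / (4 * INR m))%R * tau)) r)
     IZR (theta m mu tau) w) as (l & h3 & h4).
  - intros w' _. eapply hsum_ext; [|apply hsum_theta; auto].
    intros r. unfold D, restrict, theta_term. destruct excluded_middle_informative; ring.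
  - eapply summable_ext; [|apply (summable_theta m tau w 2 D hm ht)].
    intros r. unfold restrict, theta_term. destruct excluded_middle_informative; ring.
  - exists l; split; auto. eapply hsum_ext; [|exact h3].
    intros r. unfold restrict, theta_term. destruct excluded_middle_informative; ring. }
destruct (choice_function _ hz) as [lz hlz].
destruct (hsum_hderive (fun r => 2 * PI * Ci * IZR r *
      restrict D (fun r => ee ((IZR r ^ 2 / (4 * INR m))%R * tau)) r)
     IZR lz z) as (lzz & h3 & h4).
{ intros w _. eapply hsum_ext; [|apply hlz].
  intros r. unfold restrict, theta_term. destruct excluded_middle_informative; ring. }
{ eapply summable_ext; [|apply summable_scal with (c := 2 * PI * Ci), (summable_theta m tau z 3 D hm ht)].
  intros r. unfold restrict, theta_term. destruct excluded_middle_informative; [|ring].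
  rewrite !RtoC_pow. ring. }
exists lt, lz, lzz. repeat split; try apply hlz; try apply h2; try apply h4.
apply (hsum_scal (8 * PI * Ci * INR m)) in h1.
eapply hsum_unique; [exact h1|]. eapply hsum_ext; [|exact h3].
intros r.
unfold restrict; destruct excluded_middle_informative; [|ring].
replace (IZR r ^ 2 / (4 * INR m))%R with (IZR r * IZR r * / (4 * INR m))%R by (field; lra).
set (E1 := ee _). set (E2 := ee _).
replace (RtoC (IZR r * IZR r * / (4 * INR m))) with (IZR r * IZR r * / (4 * INR m)).
2:{ rewrite !RtoC_mult, RtoC_inv, RtoC_mult; [easy|lra]. }
field. intros e; apply RtoC_inj in e; lra.
Qed.

(** * Theta decomposition *)

Lemma sum_n_m_single (f : nat -> C) (a b i : nat) : (a <= i <= b)%nat ->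
  (forall j, (a <= j <= b)%nat -> j <> i -> f j = 0) ->
  sum_n_m (G := C_AbelianGroup) f a b = f i.
Proof.
intros hi h.
assert (hz : forall p q, (forall j, (p <= j <= q)%nat -> f j = 0) -> sum_n_m (G := C_AbelianGroup) f p q = RtoC 0).
{ intros p q hpq. rewrite (sum_n_m_ext_loc (G := C_AbelianGroup) f (fun _ => zero)) by exact hpq.
  apply (sum_n_m_const_zero (G := C_AbelianGroup)). }
rewrite (sum_n_m_Chasles (G := C_AbelianGroup) f a i b) by lia.
rewrite (hz (S i) b) by (intros; apply h; lia).
destruct (Nat.eq_dec a i) as [->|n].
- rewrite sum_n_n. apply Cplus_0_r.
- destruct i as [|i]; [lia|]. rewrite (sum_n_Sm (G := C_AbelianGroup)) by lia.
  rewrite (hz a i) by (intros; apply h; lia).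
  change (0 + f (S i) + 0 = f (S i)). ring.
Qed.

Lemma hsum_sum_n_m {I : Type} (x : nat -> I -> C) (s : nat -> C) (a b : nat) :
  (forall j, (a <= j <= b)%nat -> hsum (x j) (s j)) ->
  hsum (fun i => sum_n_m (G := C_AbelianGroup) (fun j => x j i) a b)
       (sum_n_m (G := C_AbelianGroup) s a b).
Proof.
intros h. destruct (Nat.le_gt_cases a b) as [hab|hab].
- induction b as [|b IH].
  + replace a with 0%nat in * by lia. rewrite sum_n_n.
    apply hsum_ext with (x 0%nat); [intros; now rewrite sum_n_n|]. apply h; lia.
  + destruct (Nat.eq_dec a (S b)) as [->|n].
    * rewrite sum_n_n. apply hsum_ext with (x (S b)); [intros; now rewrite sum_n_n|]. apply h; lia.
    * rewrite sum_n_Sm by lia.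
      apply hsum_ext with
        (fun i => sum_n_m (G := C_AbelianGroup) (fun j => x j i) a b + x (S b) i);
        [intros; rewrite sum_n_Sm by lia; reflexivity|].
      apply hsum_plus; [apply IH; [intros; apply h|]|apply h]; lia.
- rewrite sum_n_m_zero by lia.
  apply hsum_ext with (fun _ => 0); [intros; now rewrite sum_n_m_zero by lia|].
  apply hsum_zero.
Qed.

Lemma theta_class_exists (m : nat) (r : Z) : (0 < m)%nat ->
  exists mu, (1 <= mu <= 2 * m)%nat /\ theta_class m mu r.
Proof.
(* Representatives run from 1 to [2 m], hence the shift by one around [mod]. *)
intros hm. exists (Z.to_nat ((r - 1) mod (2 * Z.of_nat m)) + 1)%nat.
assert (h := Z.mod_pos_bound (r - 1) (2 * Z.of_nat m) ltac:(lia)).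
split; [lia|]. exists ((r - 1) / (2 * Z.of_nat m))%Z.
rewrite Nat2Z.inj_add, Z2Nat.id by lia.
assert (e := Z.div_mod (r - 1) (2 * Z.of_nat m) ltac:(lia)). lia.
Qed.

(* This is [d mu] for the unique [mu] in [1 .. 2 m] congruent to [r]. *)
Definition residue_value (m : nat) (d : nat -> C) (r : Z) : C :=
  sum_n_m (G := C_AbelianGroup) (fun mu => d mu * restrict (theta_class m mu) (fun _ => 1) r) 1 (2 * m).

Lemma residue_value_class (m : nat) (d : nat -> C) (mu : nat) (r : Z) :
  (1 <= mu <= 2 * m)%nat -> theta_class m mu r -> residue_value m d r = d mu.
Proof.
intros hmu hr. unfold residue_value. rewrite (sum_n_m_single _ _ _ mu hmu).
- rewrite restrict_in by easy. ring.
- intros j hj n. rewrite restrict_out; [ring|]. intros hr'.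
  destruct hr as [p hp], hr' as [q hq]. apply n.
  assert (e : (Z.of_nat j - Z.of_nat mu = (p - q) * (2 * Z.of_nat m))%Z) by lia.
  assert (p - q = 0)%Z by nia. nia.
Qed.

(** Merges the [2 m] theta series into one Fourier series in [z], to which uniqueness of
    coefficients applies. *)
Lemma hsum_theta_combination (m : nat) (d : nat -> C) (tau z : C) : (0 < m)%nat -> upper tau ->
  hsum (fun r => residue_value m d r * theta_term m tau z r)
       (sum_n_m (G := C_AbelianGroup) (fun mu => d mu * theta m mu tau z) 1 (2 * m)).
Proof.
intros hm ht.
eapply hsum_ext; [|apply (hsum_sum_n_m (fun mu r => d mu * restrict (theta_class m mu) (theta_term m tau z) r))].
- intros r; cbv beta. unfold residue_value.
  rewrite <- (sum_n_m_mult_r (K := C_Ring)). apply sum_n_m_ext. intros mu.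
  unfold restrict. destruct excluded_middle_informative; simpl; unfold mult; simpl; ring.
- intros mu _. apply hsum_scal, hsum_theta; auto.
Qed.

Lemma theta_series_unique (m : nat) (tau : C) (d : Z -> C) :
  (forall z, hsum (fun r => d r * theta_term m tau z r) 0) -> forall r, d r = 0.
Proof.
intros h r. set (q := fun r : Z => ee ((IZR r ^ 2 / (4 * INR m))%R * tau)).
assert (e : d r * q r = 0).
{ apply (trigonometric_series_unique (fun r => d r * q r)). intros z.
  eapply hsum_ext; [|apply (h z)]. intros i; simpl. unfold theta_term, q; simpl. ring. }
replace (d r) with (d r * q r * / q r) by (field; apply ee_neq_0). rewrite e; ring.
Qed.

Lemma theta_decomposition_unique (m : nat) (F : C -> C -> C) (h h' : nat -> C -> C) :
  (0 < m)%nat -> theta_decomposition m F h -> theta_decomposition m F h' ->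
  forall mu tau, (1 <= mu <= 2 * m)%nat -> upper tau -> h mu tau = h' mu tau.
Proof.
intros hm hh hh' mu tau hmu ht.
assert (e : forall r, residue_value m (fun mu => h mu tau) r - residue_value m (fun mu => h' mu tau) r = 0).
{ apply (theta_series_unique m tau). intros z.
  replace (RtoC 0) with (F tau z - F tau z) by ring.
  rewrite (hh tau z ht) at 1. rewrite (hh' tau z ht).
  eapply hsum_ext; [|apply hsum_minus; apply hsum_theta_combination; auto].
  intros r; cbv beta; ring. }
specialize (e (Z.of_nat mu)).
rewrite !(residue_value_class m _ mu) in e by
  (auto; unfold theta_class; rewrite Z.sub_diag; apply Z.divide_0_r).
replace (h mu tau) with (h mu tau - h' mu tau + h' mu tau) by ring. rewrite e; ring.
Qed.

Lemma Psi_unique (m : nat) (F : C -> C -> C) (h : nat -> C -> C) :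
  (0 < m)%nat -> theta_decomposition m F h ->
  forall mu tau, (1 <= mu <= 2 * m)%nat -> upper tau -> Psi m F mu tau = h mu tau.
Proof.
intros hm hh. apply theta_decomposition_unique with F; auto.
unfold Psi. apply epsilon_spec. now exists h.
Qed.

Lemma theta_decomposition_Psi (m : nat) (F : C -> C -> C) (h : nat -> C -> C) :
  theta_decomposition m F h -> theta_decomposition m F (Psi m F).
Proof. intros hh. unfold Psi. apply epsilon_spec. now exists h. Qed.

(** * Existence of the theta decomposition of a Jacobi form *)

(** The slash action of the identity matrix carries a constant [c0] built from [chi] and a power of
    1. Comparing the translation by [p] with the trivial translation, which carries the same [c0],
    cancels it without computing it. *)
Lemma jacobi_form_translation (k : R) (m : nat) (chi : SL2Z -> C) (f : C -> C -> C) :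
  jacobi_form k m chi f -> forall (tau z : C) (p : Z), upper tau ->
  f tau (z + IZR p * tau) * ee (INR m * (IZR p ^ 2 * tau + 2 * IZR p * z)) = f tau z.
Proof.
intros (_ & hinv & _) tau z p ht.
set (id := mkSL2Z 1 0 0 1 eq_refl).
assert (hj : autj id tau = 1) by (unfold autj; simpl; ring).
assert (hm : moebius id tau = tau) by (unfold moebius; rewrite hj; simpl; field).
set (c0 := / chi id * Cpower (autj id tau) (- k)).
assert (hs : forall (q : Z) (w : C), c0 * f tau (w + IZR q * tau) * ee (INR m * (IZR q ^ 2 * tau + 2 * IZR q * w)) = f tau w).
{ intros q w. rewrite <- (hinv (id, (q, 0%Z)) tau w ht) at 1. unfold jacobi_slash. simpl fst; simpl snd.
  fold c0. rewrite hm. simpl sl_c. rewrite hj.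
  replace ((w + IZR q * tau + 0%R) / 1) with (w + IZR q * tau) by field.
  f_equal. f_equal. field. }
assert (h1 := hs 0%Z (z + IZR p * tau)).
rewrite <- (hs p z).
replace (INR m * (0%R ^ 2 * tau + 2 * 0%R * (z + IZR p * tau))) with (RtoC 0) in h1 by ring.
replace (z + IZR p * tau + 0%R * tau) with (z + IZR p * tau) in h1 by ring.
rewrite ee_0, Cmult_1_r in h1. rewrite h1. reflexivity.
Qed.

Lemma Cmult_minus_distr_r (a b c : C) : (a - b) * c = a * c - b * c.
Proof. ring. Qed.

Lemma jacobi_form_decomposition (k : R) (m : nat) (chi : SL2Z -> C) (f : C -> C -> C) :
  (0 < m)%nat -> jacobi_form k m chi f ->
  exists h : nat -> C -> C, theta_decomposition m f h /\ forall mu, qseries (h mu).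
Proof.
intros hm hf. assert (htr := jacobi_form_translation k m chi f hf).
destruct hf as (_ & _ & kappa & c & _ & hc). assert (hm' := lt_0_INR _ hm).
(* What remains of the exponent [n + kappa] once the theta factor [r^2 / 4m] is split off; the
   support condition on the coefficients says exactly that it is nonnegative. *)
set (lam := fun r n : Z => (IZR n + kappa - IZR r ^ 2 / (4 * INR m))%R).
set (a := fun r n : Z => restrict (fun n => (0 <= lam r n)%R) (fun n => c n r) n).
assert (hdom : forall n r, (IZR r ^ 2 - 4 * INR m * (IZR n + kappa) <= 0 <-> 0 <= lam r n)%R).
{ intros n r. replace (IZR r ^ 2 - 4 * INR m * (IZR n + kappa))%R with (- (4 * INR m * lam r n))%R
    by (unfold lam; field; lra).
  assert (h4 : (0 < 4 * INR m)%R) by lra. split; intros h.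
  - apply Rmult_le_reg_l with (1 := h4). lra.
  - assert (0 <= 4 * INR m * lam r n)%R by (apply Rmult_le_pos; lra). lra. }
assert (hf : forall tau z, upper tau ->
   hsum (fun p => a (snd p) (fst p) * ee (lam (snd p) (fst p) * tau) * theta_term m tau z (snd p)) (f tau z)).
{ intros tau z ht. specialize (hc tau z ht). apply has_sum_restrict in hc.
  revert hc; apply hsum_ext. intros [n r]; cbn [fst snd]. unfold a, theta_term.
  assert (e : ee (lam r n * tau) * ee ((IZR r ^ 2 / (4 * INR m))%R * tau) = ee ((IZR n + kappa)%R * tau)).
  { rewrite <- ee_plus. f_equal. unfold lam. rewrite <- Cmult_plus_distr_r, <- RtoC_plus. f_equal. f_equal. ring. }
  unfold restrict; cbn [fst snd].
  destruct excluded_middle_informative as [h1|h1], excluded_middle_informative as [h2|h2]; try rewrite <- e; try ring;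
    exfalso; generalize (hdom n r); tauto. }
assert (hS : forall r tau, exists s, upper tau -> hsum (fun n => a r n * ee (lam r n * tau)) s).
{ intros r tau. destruct (excluded_middle_informative (upper tau)) as [ht|]; [|now exists 0].
  destruct (summable_hsum (fun n => a r n * ee (lam r n * tau))) as [s hs]; [|now exists s].
  (* The slice at fixed [r] inherits absolute convergence from the double series at [z = 0], and its
     nonzero theta factor can be divided out. *)
  assert (hs := hsum_summable _ _ (hf tau 0 ht)).
  apply (summable_inj (fun n : Z => (n, r))) in hs; [|intros i i' e; now injection e].
  apply summable_scal with (c := / theta_term m tau 0 r) in hs.
  revert hs; apply summable_ext. intros n; simpl. field. apply theta_term_neq_0. }
destruct (choice_function _ (fun r => choice_function _ (hS r))) as [S hS'].
assert (hfS : forall tau z, upper tau -> hsum (fun r => S r tau * theta_term m tau z r) (f tau z)).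
{ intros tau z ht. apply (hsum_fubini _ _ _ (hf tau z ht)). intros r; simpl.
  replace (S r tau * theta_term m tau z r) with (theta_term m tau z r * S r tau) by ring.
  eapply hsum_ext; [|apply hsum_scal, hS', ht]. intros n; simpl; ring. }
(* Since [(r + 2mp)^2 / 4m = r^2 / 4m + rp + m p^2], the translation by [p tau] carries the [r]-th
   theta term to the one of index [r + 2mp]; comparing coefficients gives the periodicity. *)
assert (hper : forall p r tau, upper tau -> S r tau = S (r - 2 * Z.of_nat m * p)%Z tau).
{ intros p r tau ht.
  assert (e : forall r, S r tau - S (r - 2 * Z.of_nat m * p)%Z tau = 0).
  { apply (theta_series_unique m tau). intros z.
    replace (RtoC 0) with (f tau z - f tau z) by ring.
    eapply hsum_ext; [|apply hsum_minus; [apply (hfS tau z ht)|]].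
    - intros i; cbv beta. apply eq_sym, Cmult_minus_distr_r.
    - apply (hsum_inj (fun i => (i + 2 * Z.of_nat m * p)%Z)).
      + intros i i' e; lia.
      + intros j; left; exists (j - 2 * Z.of_nat m * p)%Z; lia.
      + rewrite <- (htr tau z p ht), Cmult_comm.
        eapply hsum_ext; [|apply hsum_scal, (hfS tau _ ht)].
        intros i; cbv beta.
        replace (i + 2 * Z.of_nat m * p - 2 * Z.of_nat m * p)%Z with i by ring.
        unfold theta_term.
        rewrite <- !ee_plus.
        rewrite Cmult_comm, <- Cmult_assoc, <- ee_plus. f_equal. f_equal.
        rewrite plus_IZR, !mult_IZR, <- INR_IZR_INZ.
        replace ((IZR i + 2 * INR m * IZR p) ^ 2 / (4 * INR m))%R
          with (IZR i ^ 2 / (4 * INR m) + IZR i * IZR p + INR m * IZR p ^ 2)%R by (field; lra).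
        rewrite !RtoC_plus, !RtoC_mult, !RtoC_pow. ring. }
  replace (S r tau) with (S r tau - S (r - 2 * Z.of_nat m * p)%Z tau + S (r - 2 * Z.of_nat m * p)%Z tau) by ring.
  rewrite e; ring. }
exists (fun mu => S (Z.of_nat mu)). split.
- intros tau z ht. apply (hsum_unique (fun r => S r tau * theta_term m tau z r)); auto.
  eapply hsum_ext; [|apply (hsum_theta_combination m (fun mu => S (Z.of_nat mu) tau) tau z hm ht)].
  intros r; cbv beta. f_equal.
  destruct (theta_class_exists m r hm) as (mu & hmu & hr).
  rewrite (residue_value_class m _ mu r hmu hr).
  destruct hr as [p hp]. rewrite (hper p r tau ht). f_equal. lia.
- intros mu. exists (a (Z.of_nat mu)), (lam (Z.of_nat mu)). split.
  + intros n hn. apply restrict_out. lra.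
  + intros tau ht. now apply hS'.
Qed.

(** * Theta decompositions under the heat operator and the bracket *)

Lemma sum_n_m_Cmult_l (c : C) (u : nat -> C) (a b : nat) :
  sum_n_m (G := C_AbelianGroup) (fun i => c * u i) a b = c * sum_n_m (G := C_AbelianGroup) u a b.
Proof. exact (sum_n_m_mult_l (K := C_Ring) c u a b). Qed.

(** The scalar [c] accumulates the powers of [4 m] under iteration, so that [h] stays an iterated
    [Dtau] of a q-series. *)
Lemma theta_decomposition_heat (m : nat) (F : C -> C -> C) (h : nat -> C -> C) (c : C) :
  (0 < m)%nat -> (forall mu, (1 <= mu <= 2 * m)%nat -> qseries (h mu)) ->
  theta_decomposition m F (fun mu t => c * h mu t) ->
  theta_decomposition m (heat m F) (fun mu t => c * (4 * INR m) * Dtau (h mu) t).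
Proof.
intros hm hq hF tau z ht.
destruct (choice_function _ (fun mu => theta_heat m mu tau z hm ht)) as [lt H1].
destruct (choice_function _ H1) as [lz H2]. destruct (choice_function _ H2) as [lzz H].
clear H1 H2.
assert (e1 : C_derive (fun t => F t z) tau =
  sum_n_m (G := C_AbelianGroup) (fun mu =>
    (c * (2 * PI * Ci * Dtau (h mu) tau)) * theta m mu tau z + c * h mu tau * lt mu) 1 (2 * m)).
{ apply is_hderive_unique.
  eapply is_hderive_ext; [intros w hw; symmetry; apply hF; unfold upper; now rewrite hw|].
  apply (is_hderive_sum (fun mu w => c * h mu w * theta m mu w z)). intros mu hmu.
  destruct (H mu) as (d & _). refine (is_hderive_mult _ _ _ _ _ _ d).
  apply is_hderive_scal. exact (proj2 (qseries_Dtau _ (hq mu hmu)) tau ht). }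
assert (e2 : forall w, C_derive (fun w' => F tau w') w =
  sum_n_m (G := C_AbelianGroup) (fun mu => c * h mu tau * lz mu w) 1 (2 * m)).
{ intros w. apply is_hderive_unique.
  eapply is_hderive_ext; [intros w' hw; symmetry; now apply hF|].
  apply (is_hderive_sum (fun mu w => c * h mu tau * theta m mu tau w)). intros mu hmu.
  destruct (H mu) as (_ & d & _). exact (is_hderive_scal _ _ _ _ (d w)). }
assert (e3 : C_derive (fun w => C_derive (fun w' => F tau w') w) z =
  sum_n_m (G := C_AbelianGroup) (fun mu => c * h mu tau * lzz mu) 1 (2 * m)).
{ apply is_hderive_unique.
  eapply is_hderive_ext; [intros w' hw; symmetry; apply e2|].
  apply (is_hderive_sum (fun mu w => c * h mu tau * lz mu w)). intros mu hmu.
  destruct (H mu) as (_ & _ & d & _). exact (is_hderive_scal _ _ _ _ d). }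
unfold heat. rewrite e1, e3.
assert (hpi := PI_RGT_0). assert (hpi' : RtoC PI <> 0) by (intros e; apply RtoC_inj in e; lra).
set (A := - / (4 * PI ^ 2)). set (B := 8 * PI * Ci * INR m).
replace (A * (B * sum_n_m (G := C_AbelianGroup) (fun mu =>
    (c * (2 * PI * Ci * Dtau (h mu) tau)) * theta m mu tau z + c * h mu tau * lt mu) 1 (2 * m) -
    sum_n_m (G := C_AbelianGroup) (fun mu => c * h mu tau * lzz mu) 1 (2 * m)))
 with (A * B * sum_n_m (G := C_AbelianGroup) (fun mu =>
    (c * (2 * PI * Ci * Dtau (h mu) tau)) * theta m mu tau z + c * h mu tau * lt mu) 1 (2 * m) +
    (- A) * sum_n_m (G := C_AbelianGroup) (fun mu => c * h mu tau * lzz mu) 1 (2 * m)) by ring.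
rewrite <- !sum_n_m_Cmult_l, <- (sum_n_m_plus (G := C_AbelianGroup)).
apply (sum_n_m_ext (G := C_AbelianGroup)). intros mu.
destruct (H mu) as (_ & _ & _ & <-). fold B.
change (A * B * (c * (2 * PI * Ci * Dtau (h mu) tau) * theta m mu tau z + c * h mu tau * lt mu) +
  - A * (c * h mu tau * (B * lt mu)) = c * (4 * INR m) * Dtau (h mu) tau * theta m mu tau z).
(* The terms with [lt mu] have cancelled by [theta_heat]; the normalisation of [heat] turns what is
   left of the [tau]-derivative into [4 m] times [Dtau]. *)
assert (e : A * B * (2 * PI * Ci) = 4 * INR m).
{ unfold A, B.
  replace (- / (4 * PI ^ 2) * (8 * PI * Ci * INR m) * (2 * PI * Ci))
    with ((Ci * Ci) * (- (4 * INR m))) by (field; exact hpi').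
  replace (Ci * Ci) with (- (1)) by (apply injective_projections; simpl; ring). ring. }
rewrite <- e. ring.
Qed.

Lemma theta_decomposition_iter_heat (m : nat) (F : C -> C -> C) (h : nat -> C -> C) (r : nat) :
  (0 < m)%nat -> (forall mu, (1 <= mu <= 2 * m)%nat -> qseries (h mu)) ->
  theta_decomposition m F h ->
  theta_decomposition m (Nat.iter r (heat m) F) (fun mu t => (4 * INR m) ^ r * Nat.iter r Dtau (h mu) t).
Proof.
intros hm hq hF. induction r as [|r IH].
- intros tau z ht. simpl Nat.iter. rewrite (hF tau z ht).
  apply (sum_n_m_ext (G := C_AbelianGroup)). intros mu. simpl. ring.
- intros tau z ht. simpl Nat.iter.
  rewrite (theta_decomposition_heat m _ (fun mu => Nat.iter r Dtau (h mu)) _ hm) with (2 := IH); auto.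
  + apply (sum_n_m_ext (G := C_AbelianGroup)). intros mu. simpl. ring.
  + intros mu hmu. now apply qseries_iter_Dtau, hq.
Qed.

Lemma theta_decomposition_mult (m : nat) (F : C -> C -> C) (h : nat -> C -> C) (c : C -> C) :
  theta_decomposition m F h ->
  theta_decomposition m (fun tau z => c tau * F tau z) (fun mu tau => c tau * h mu tau).
Proof.
intros hF tau z ht. rewrite (hF tau z ht), <- sum_n_m_Cmult_l.
apply (sum_n_m_ext (G := C_AbelianGroup)). intros mu. simpl. ring.
Qed.

Lemma theta_decomposition_sum (m n : nat) (F : nat -> C -> C -> C) (h : nat -> nat -> C -> C) :
  (forall r, theta_decomposition m (F r) (h r)) ->
  theta_decomposition m (fun tau z => sum_n (G := C_AbelianGroup) (fun r => F r tau z) n)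
    (fun mu tau => sum_n (G := C_AbelianGroup) (fun r => h r mu tau) n).
Proof.
intros hF tau z ht. induction n as [|n IH].
- rewrite sum_O, (hF 0%nat tau z ht).
  apply (sum_n_m_ext (G := C_AbelianGroup)). intros mu. now rewrite sum_O.
- rewrite sum_Sn, IH, (hF (S n) tau z ht), <- (sum_n_m_plus (G := C_AbelianGroup)).
  apply (sum_n_m_ext (G := C_AbelianGroup)). intros mu. rewrite sum_Sn.
  unfold plus; simpl. ring.
Qed.

(** For each [r] the binomials and the derivative of [g] do not involve [z], so they act as a scalar
    on the decomposition of the iterated heat operator. *)
Lemma theta_decomposition_bracket (k : R) (m : nat) (l : R) (nu : nat)
    (f : C -> C -> C) (g : C -> C) (h : nat -> C -> C) :
  (0 < m)%nat -> (forall mu, (1 <= mu <= 2 * m)%nat -> qseries (h mu)) ->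
  theta_decomposition m f h ->
  theta_decomposition m (hol_bracket k m l nu f g)
    (fun mu tau => sum_n (G := C_AbelianGroup)
      (fun r => gbinom (INR nu + k - 3 / 2) (nu - r) * gbinom (INR nu + l - 1) r *
         (- (4 * INR m)) ^ (nu - r) * Nat.iter (nu - r) Dtau g tau *
         ((4 * INR m) ^ r * Nat.iter r Dtau (h mu) tau)) nu).
Proof.
intros hm hq hf tau z ht.
rewrite <- (theta_decomposition_sum m nu _ _
  (fun r => theta_decomposition_mult m _ _
    (fun tau => gbinom (INR nu + k - 3 / 2) (nu - r) * gbinom (INR nu + l - 1) r *
         (- (4 * INR m)) ^ (nu - r) * Nat.iter (nu - r) Dtau g tau)
    (theta_decomposition_iter_heat m f h r hm hq hf)) tau z ht).
unfold hol_bracket. apply (sum_n_ext (G := C_AbelianGroup)). intros r; simpl. ring.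
Qed.

(** * Comparison of coefficients and conclusion *)

Lemma qseries_ext (h h' : C -> C) :
  (forall tau, upper tau -> h tau = h' tau) -> qseries h -> qseries h'.
Proof.
intros e (a & lam & hl & hs). exists a, lam. split; auto.
intros tau ht. rewrite <- e by easy. now apply hs.
Qed.

Lemma gbinom_rising (x y : R) (n : nat) : (y = x + INR n - 1)%R ->
  gbinom y n = (rising x n / INR (fact n))%R.
Proof. intros ->. unfold gbinom. now rewrite falling_rising. Qed.

(** The binomials are [rising (k - 1/2 + i) (nu - i) / (nu - i)!] and [rising (l + nu - i) i / i!].
    The rising factorials are the Gamma quotients, and [1 / (i! (nu - i)!)] is the binomial
    coefficient over [nu!]. *)
Lemma bracket_coefficient (k l : R) (nu i : nat) : (i <= nu)%nat ->
  (gbinom (INR nu + k - 3 / 2) (nu - i) * gbinom (INR nu + l - 1) i =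
   / INR (fact nu) * (Binomial.C nu i *
     (Gamma_quotient (k - 1 / 2 + INR nu) (k - 1 / 2 + INR i) *
      Gamma_quotient (l + INR nu) (l + INR nu - INR i))))%R.
Proof.
intros hi.
assert (e : INR nu = (INR (nu - i) + INR i)%R) by (rewrite <- plus_INR; f_equal; lia).
rewrite (gbinom_rising (k - 1 / 2 + INR i)%R) by (rewrite e; field).
rewrite (gbinom_rising (l + INR nu - INR i)%R) by ring.
replace (Gamma_quotient (k - 1 / 2 + INR nu) (k - 1 / 2 + INR i))
  with (rising (k - 1 / 2 + INR i) (nu - i))
  by (rewrite <- Gamma_quotient_add; f_equal; rewrite e; ring).
replace (Gamma_quotient (l + INR nu) (l + INR nu - INR i))
  with (rising (l + INR nu - INR i) i)
  by (rewrite <- Gamma_quotient_add; f_equal; ring).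
unfold Binomial.C. field. repeat split; apply INR_fact_neq_0.
Qed.

Theorem theorem4p6 (m nu : nat) (k l : R) (chi chi1 : SL2Z -> C)
    (f : C -> C -> C) (g : C -> C)
    (hm : (0 < m)%nat) (hnu : (0 < nu)%nat)
    (hchi : multiplier_system k chi) (hchi1 : multiplier_system l chi1)
    (hf : jacobi_form k m chi f) (hg : modular_form l chi1 g) :
  forall tau : C, upper tau -> forall mu : nat, (1 <= mu <= 2 * m)%nat ->
    1 / (4 * INR m) ^ nu * Psi m (hol_bracket k m l nu f g) mu tau =
    1 / INR (fact nu) * RC_bracket k l nu (Psi m f) g mu tau.
Proof.
intros tau ht mu hmu.
destruct (jacobi_form_decomposition k m chi f hm hf) as (h & hd & hq).
(* The components selected by [Psi] agree on the upper half-plane with the constructed [h], hence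
   inherit the series expansions. *)
assert (hq' : forall i, (1 <= i <= 2 * m)%nat -> qseries (Psi m f i)).
{ intros i hi. apply qseries_ext with (2 := hq i).
  intros t ht'. symmetry. now apply Psi_unique. }
rewrite (Psi_unique m _ _ hm (theta_decomposition_bracket k m l nu f g (Psi m f) hm hq'
  (theta_decomposition_Psi m f h hd)) mu tau hmu ht).
unfold RC_bracket, sum_n. rewrite <- !sum_n_m_Cmult_l.
apply (sum_n_m_ext_loc (G := C_AbelianGroup)). intros i [_ hi].
assert (hm' : RtoC (4 * INR m) <> 0).
{ intros e; apply RtoC_inj in e. assert (h' := lt_0_INR _ hm). lra. }
rewrite RtoC_mult in hm'.
(* The heat operator supplies [(4m)^i] and the bracket [(-4m)^(nu-i)]; after division by [(4m)^nu]
   only the sign survives. *)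
assert (hp : (4 * INR m) ^ nu = (4 * INR m) ^ (nu - i) * (4 * INR m) ^ i).
{ rewrite <- Cpow_add_r. f_equal. lia. }
replace (- (4 * INR m)) with (- (1) * (4 * INR m)) by ring.
rewrite (Cpow_mult_l (- (1))), hp.
rewrite <- (RtoC_mult (gbinom _ _)), bracket_coefficient by easy.
assert (hfac : RtoC (INR (fact nu)) <> 0).
{ intros e; apply RtoC_inj in e. now apply INR_fact_neq_0 in e. }
rewrite !RtoC_mult, RtoC_inv by apply INR_fact_neq_0.
assert (h1 := Cpow_nz _ i hm'). assert (h2 := Cpow_nz _ (nu - i) hm').
set (P1 := (4 * INR m) ^ (nu - i)) in *. set (P2 := (4 * INR m) ^ i) in *.
simpl. field. auto.
Qed.
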